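(* $Z^0(\mathbb R^2)$ is continuously embedded in $H^{2/3}_xL^2_z=H^{2/3}(\mathbb R;L^2(\mathbb R))$: there is $C>0$ such that $\|\phi\|_{H^{2/3}_xL^2_z}\le C\|\phi\|_{Z^0}$ for all $\phi\in Z^0(\mathbb R^2)$.
   Context: For an open set $\mathcal O\subset\mathbb R^2$ with coordinates $(x,z)$, $Z^0(\mathcal O)$ is the space of $\phi$ such that $\phi,\partial_z\phi,\partial_{zz}\phi$ and $z\partial_x\phi$ belong to $L^2(\mathcal O)$ (distributional derivatives), with norm $\|\phi\|_{Z^0}=\|z\partial_x\phi\|_{L^2}+\|\partial_{zz}\phi\|_{L^2}+\|\partial_z\phi\|_{L^2}+\|\phi\|_{L^2}$. *)

(* Defs.v *)
From HB Require Import structures.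
From mathcomp Require Import all_boot all_order all_algebra.
From mathcomp Require Import all_classical all_reals all_analysis.
Set Implicit Arguments. Unset Strict Implicit. Unset Printing Implicit Defensive.
Import Order.TTheory GRing.Theory Num.Theory.
Local Open Scope classical_set_scope.
Local Open Scope ring_scope.

Section Defs.
Variable R : realType.

Definition leb := (@lebesgue_measure R).
Definition leb2 := (leb \x leb)%E.

Definition test_fun (f : R -> R) : Prop :=
  (forall (n : nat) (x : R), derivable (derive1n n f) x 1) /\
  (exists M : R, forall x, M < `|x| -> f x = 0).

Definition L2 (f : R * R -> R) : Prop :=
  measurable_fun setT f /\
  (\int[leb2]_p ((`|f p| ^+ 2)%:E) < +oo)%E.

Definition L2norm (f : R * R -> R) : \bar R := Lnorm leb2 2%:E (EFin \o f).

(* g is the distributional derivative d/dz of phi (tested against the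
   tensor products psi1(x) psi2(z) of test functions) *)
Definition weak_dz (phi g : R * R -> R) : Prop :=
  forall psi1 psi2 : R -> R, test_fun psi1 -> test_fun psi2 ->
  (\int[leb2]_p ((phi p * (psi1 p.1 * (derive1 psi2) p.2))%:E) =
   - \int[leb2]_p ((g p * (psi1 p.1 * psi2 p.2))%:E))%E.

(* h is the distribution z * d/dx phi, i.e. <z d_x phi, psi> = - <phi, d_x (z psi)> *)
Definition weak_z_dx (phi h : R * R -> R) : Prop :=
  forall psi1 psi2 : R -> R, test_fun psi1 -> test_fun psi2 ->
  (\int[leb2]_p ((phi p * ((derive1 psi1) p.1 * (p.2 * psi2 p.2)))%:E) =
   - \int[leb2]_p ((h p * (psi1 p.1 * psi2 p.2))%:E))%E.

Definition inZ0 (phi gz gzz h : R * R -> R) : Prop :=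
  L2 phi /\ L2 gz /\ L2 gzz /\ L2 h /\
  weak_dz phi gz /\ weak_dz gz gzz /\ weak_z_dx phi h.

Definition Z0norm (phi gz gzz h : R * R -> R) : \bar R :=
  (L2norm h + L2norm gzz + L2norm gz + L2norm phi)%E.

(* H^{2/3}_x L^2_z norm (Sobolev-Slobodeckij form, s = 2/3):
   ( ||phi||_{L^2}^2 + int_z int_x int_y |phi(x,z)-phi(y,z)|^2/|x-y|^{1+2s} )^{1/2} *)
Definition H23xL2z_norm (phi : R * R -> R) : \bar R :=
  ((\int[leb2]_p ((`|phi p| ^+ 2)%:E) +
    \int[leb]_z \int[leb]_x \int[leb]_y
       ((`|phi (x, z) - phi (y, z)| ^+ 2 / (`|x - y| `^ (7 / 3)))%:E))
   `^ (2^-1)%R)%E.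

End Defs.

(* Main.v *)
Require Import Defs.
From HB Require Import structures.
From mathcomp Require Import all_boot all_order all_algebra.
From mathcomp Require Import all_classical all_reals all_analysis.
From mathcomp Require Import measurable_realfun ring lra.
Set Implicit Arguments. Unset Strict Implicit. Unset Printing Implicit Defensive.
Import Order.TTheory GRing.Theory Num.Theory.
Import numFieldNormedType.Exports.
Local Open Scope classical_set_scope.
Local Open Scope ring_scope.

(** With [J t] the integral over the plane of [(phi (x + t, z) - phi (x, z))^2],
    the Slobodeckij seminorm is twice the integral of [t^(-7/3) * J t] over
    [t > 0]; set [s = t^(1/3)].  Where [s <= |z|], the increment is [1/z] times
    the integral of [z d_x phi] over [[x, x + t]], and Cauchy-Schwarz gives
    [t^2 |z|^-2 |z d_x phi|^2]; integrating [t^(-1/3)] over [t <= |z|^3] cancels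
    [|z|^-2].  Where [|z| < s], write [phi (z)] as
    [2 phi (z + 2 s) - phi (z + 4 s)] plus a second difference in [z]: the first
    two terms fall in the previous region, and the second difference is at most
    [2 s] times the integral of [|d_zz phi|] over [|w| < 5 s], so that integrating
    in [t] is Hardy's inequality in the variable [z].  Both bounds converge without
    logarithmic loss because the degeneracy is located at [z = 0], so no
    Littlewood-Paley decomposition in [x] is needed.

    The weak derivatives are turned into difference identities valid almost
    everywhere, for each fixed step, by testing against
    [w |-> \int_(w - s)^w psi], whose derivative is [psi w - psi (w - s)]. *)

(** * Smooth functions and [exp (-1/x)] *)

(** Under the scaling [x ~ z^3] both [z d_x] and [d_zz] behave like [z^-2], that is like [t^(-2/3)]:
    hence the exponent [2/3] and the splitting scale [t^(1/3)]. The extrapolation from [z + 2 s] and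
    [z + 4 s] is exact on functions affine in [z], so its error is seen by [d_zz phi] alone; a first
    difference would use a single [z]-derivative, worth only the exponent [1/3].

    Plain Cauchy-Schwarz on the slab [|w| < 5 s] would leave [dt / t] on [t > (|w| / 5)^3], which
    diverges at infinity. Splitting off [|w|^(1/2)] replaces this by [t^(-7/6) dt], and the
    [t]-integral then returns exactly [|w|^(-1/2)].

    Two technical constraints shape the rest. The exceptional null set of a difference identity
    depends on the step, so increments are estimated as plane integrals at fixed [t], and only
    explicit densities are integrated in [t] at a fixed point. The weak derivatives are tested only
    on tensor products, so that vanishing almost everywhere has to be deduced from rectangles. *)

Section smooth.
Context {R : realType}.
Implicit Types f g : R -> R.

Definition smooth f := forall (n : nat) (x : R), derivable (derive1n n f) x 1.

Lemma derive1nSr n f : derive1n n.+1 f = derive1n n (derive1 f).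
Proof. by rewrite /derive1n iterSr. Qed.

(** Reduces smoothness to a single differentiation step inside a class, so that no formula for
    [n]-th derivatives is ever needed. *)
Lemma smooth_invariant (S : (R -> R) -> Prop) :
  (forall f, S f -> (forall x, derivable f x 1) /\ S (derive1 f)) ->
  forall f, S f -> smooth f.
Proof.
move=> HS f Sf n; elim: n f Sf => [|n IH] f Sf x; first by have [+ _] := HS _ Sf; apply.
by rewrite derive1nSr; apply: IH; have [] := HS _ Sf.
Qed.

Lemma smooth_derive1 f : smooth f -> smooth (derive1 f).
Proof. by move=> sf n x; rewrite -derive1nSr. Qed.

Lemma smooth_derivable f x : smooth f -> derivable f x 1.
Proof. by move=> /(_ 0%N x). Qed.

Lemma smoothI f : (forall x, derivable f x 1) -> smooth (derive1 f) -> smooth f.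
Proof. by move=> df sf [|n] x; [exact: df | rewrite derive1nSr]. Qed.

Lemma is_derive_fun f (df : R -> R) : (forall x : R, is_derive x (1 : R) f (df x)) ->
  (forall x, derivable f x 1) /\ derive1 f = df.
Proof.
move=> fdf; split => [x|]; first by have [] := fdf x.
by apply/funext => x; rewrite derive1E; have [_ ->] := fdf x.
Qed.

Lemma smooth_is_derive f (x : R) : smooth f -> is_derive x (1 : R) f (derive1 f x).
Proof. by move=> sf; split; [exact: smooth_derivable | rewrite derive1E]. Qed.

(* The functions [x^-k exp(-1/x)] (extended by 0): their span is stable under differentiation. *)
Definition flat (k : nat) (x : R) : R :=
  if 0 < x then x^-1 ^+ k * expR (- x^-1) else 0.

(** One term of the exponential series, [y^(k+1) / (k+1)! <= exp y]. At [y = 1/x] it gives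
    [flat k x <= (k+1)! * x], the continuity of every [flat k] at 0. *)
Lemma expr_div_expR_le (y : R) (k : nat) : 0 < y ->
  y ^+ k * expR (- y) <= k.+1`!%:R / y.
Proof.
move=> y0; rewrite expRN ler_pdivrMr ?expR_gt0// mulrAC ler_pdivlMr// -exprSr.
have := expR_ge1Dxn k (ltW y0); rewrite -ler_pdivrMl ?ltr0n ?fact_gt0//.
by apply: le_trans; rewrite mulrC lerDr.
Qed.

Lemma is_derive_flat k (x : R) :
  is_derive x (1 : R) (flat k) (- k%:R * flat k.+1 x + flat k.+2 x).
Proof.
have [x0|x0|->] := ltrgt0P x.
- apply: (@near_eq_is_derive _ _ _ (fun y : R => y^-1 ^+ k * expR (- y^-1))).
    near=> y; rewrite /flat ifT//; near: y; exact: lt_nbhsr.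
  have dV : is_derive x (1 : R) (fun y : R => y^-1) (- x ^- 2).
    by apply: is_derive_eq; [apply: is_deriveV; rewrite ?gt_eqF//|rewrite /GRing.scale/= mulr1].
  have dX := is_deriveX k dV.
  have dN := is_deriveN dV.
  have dE : is_derive x (1 : R) (expR \o (fun y : R => - y^-1)) (expR (- x^-1) * - - x ^- 2).
    by apply: is_derive1_comp.
  rewrite (_ : (fun y : R => _) = (fun y : R => y^-1) ^+ k * (expR \o (fun y : R => - y^-1))).
    apply: (is_derive_eq (is_deriveM dX dE)).
    rewrite /flat x0 /GRing.scale/= opprK !fctE -exprVn.
    case: k {dX} => [|k]; rewrite ?exprS; ring.
  by apply/funext => y; rewrite mulrfctE exprfctE.
- apply: (@near_eq_is_derive _ _ _ (cst 0 : R -> R)).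
    near=> y; rewrite /flat ifF//; apply/negbTE; rewrite -leNgt ltW//.
    by near: y; exact: lt_nbhsl.
  by rewrite /flat (lt_gtF x0) mulr0 addr0; exact: (is_derive_cst (0 : R) x (1 : R)).
- rewrite /flat ltxx mulr0 addr0.
  (* At 0 the difference quotient [flat k z / z] is [flat k.+1 z] itself, which tends to 0. *)
  apply/is_derive1_caratheodory; exists (flat k.+1); split.
  + move=> z; rewrite /flat ltxx !subr0; case: ifPn => z0; last by rewrite mul0r.
    by rewrite exprS; field; rewrite gt_eqF.
  + rewrite /prop_for /continuous_at {2}/flat ltxx; apply/cvgrPdist_le => e e0.
    near=> z; rewrite /flat sub0r normrN; case: ifPn => z0; last by rewrite normr0 ltW.
    rewrite ger0_norm; last by rewrite mulr_ge0 ?expR_ge0// exprn_ge0 ?invr_ge0 ?ltW.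
    apply: (le_trans (expr_div_expR_le _ _)); first by rewrite invr_gt0.
    rewrite invrK -ler_pdivlMl ?ltr0n ?fact_gt0//.
    apply: (le_trans (ler_norm _)); near: z; apply: (@nbhs0_le R R).
    by rewrite mulr_gt0// invr_gt0 ltr0n fact_gt0.
  + by rewrite /flat ltxx.
Unshelve. all: by end_near. Qed.

(** The constructors are chosen for stability under [derive1]: differentiating [flat k] or an affine
    substitution produces constant factors, sums and products. *)
Inductive smooth_closure : (R -> R) -> Prop :=
| Clos_smooth f of smooth f : smooth_closure f
| Clos_cst (c : R) : smooth_closure (fun=> c)
| Clos_flat k : smooth_closure (flat k)
| Clos_add f g of smooth_closure f & smooth_closure g :
    smooth_closure (fun x => f x + g x)
| Clos_mul f g of smooth_closure f & smooth_closure g :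
    smooth_closure (fun x => f x * g x)
| Clos_affine (a b : R) f of smooth_closure f :
    smooth_closure (fun x => f (a * x + b)).

Lemma smooth_closureP f : smooth_closure f -> smooth f.
Proof.
apply: smooth_invariant => {}f.
have drv g x : derivable g x 1 -> is_derive x (1 : R) g (derive1 g x).
  by move=> dg; split => //; rewrite derive1E.
elim => {f}.
- move=> f sf; split; first by move=> x; exact: smooth_derivable.
  exact/Clos_smooth/smooth_derive1.
- move=> c; have H (x : R) : is_derive x (1 : R) (fun=> c) ((fun=> 0) x).
    exact: (is_derive_cst c x (1 : R)).
  by have [? ->] := is_derive_fun H; split=> //; exact: Clos_cst.
- move=> k; have [? ->] := is_derive_fun (is_derive_flat k).
  split=> //; apply: Clos_add; last exact: Clos_flat.
  by apply: Clos_mul; [exact: Clos_cst|exact: Clos_flat].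
- move=> f g _ [df Sf] _ [dg Sg].
  have H (x : R) : is_derive x (1 : R) (fun x => f x + g x)
      ((fun x => derive1 f x + derive1 g x) x).
    by apply: (@is_deriveD _ _ _ f g); exact: drv.
  by have [? ->] := is_derive_fun H; split=> //; exact: Clos_add.
- move=> f g cf [df Sf] cg [dg Sg].
  have H (x : R) : is_derive x (1 : R) (fun x => f x * g x)
      ((fun x => f x * derive1 g x + g x * derive1 f x) x).
    by apply: (@is_deriveM _ _ f g); exact: drv.
  by have [? ->] := is_derive_fun H; split=> //; apply: Clos_add; exact: Clos_mul.
- move=> a b f cf [df Sf].
  have H (x : R) : is_derive x (1 : R) (fun x => f (a * x + b))
      ((fun x => derive1 f (a * x + b) * a) x).
    apply: (@is_derive1_comp _ f (fun x => a * x + b)); first exact: drv.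
    have da : is_derive x (1 : R) (fun x : R => a * x) (a * 1).
      exact: (is_deriveZ a (is_derive_id x (1 : R))).
    apply: (is_derive_eq (is_deriveD da (is_derive_cst b x (1 : R)))).
    by rewrite mulr1 addr0.
  have [? ->] := is_derive_fun H; split=> //.
  by apply: Clos_mul; [exact: Clos_affine|exact: Clos_cst].
Qed.

Lemma smoothB f g : smooth f -> smooth g -> smooth (fun x => f x - g x).
Proof.
move=> sf sg; apply/smooth_closureP/Clos_add; first exact: Clos_smooth.
under eq_fun do rewrite -mulN1r.
by apply: Clos_mul; [exact: Clos_cst|exact: Clos_smooth].
Qed.

Lemma smooth_shift f (s : R) : smooth f -> smooth (fun x => f (x + s)).
Proof.
move=> sf; apply: smooth_closureP.
under eq_fun do rewrite -[X in X + s]mul1r.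
exact/Clos_affine/Clos_smooth.
Qed.

End smooth.

(** * Test functions: windowed primitives and bumps *)

Section test_functions.
Context {R : realType}.
Implicit Types f g psi : R -> R.
Local Notation mu := (@lebesgue_measure R).

Lemma test_fun_continuous psi : test_fun psi -> continuous psi.
Proof.
by move=> [s _] x; apply/differentiable_continuous/derivable1_diffP; exact: (s 0%N).
Qed.

Lemma test_fun_measurable psi : test_fun psi -> measurable_fun setT psi.
Proof. by move=> /test_fun_continuous; exact: continuous_measurable_fun. Qed.

Lemma test_fun_bounded psi : test_fun psi -> exists C M : R,
  [/\ 0 <= C, 0 <= M, forall x, `|psi x| <= C & forall x, M < `|x| -> psi x = 0].
Proof.
move=> tpsi; have [_ [M0 suppM0]] := tpsi.
pose M := Num.max 0 M0.
have M_ge0 : 0 <= M by rewrite le_max lexx.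
have suppM x : M < `|x| -> psi x = 0.
  by move=> xM; apply: suppM0; rewrite (le_lt_trans _ xM)// le_max lexx orbT.
have NMM : - M <= M by rewrite (le_trans _ M_ge0)// oppr_le0.
have [c _ cmax] := EVT_max NMM
  (continuous_subspaceT (fun x => continuous_comp (@test_fun_continuous _ tpsi x)
     (@norm_continuous _ _ (psi x)))).
exists `|psi c|, M; split => // x.
have [xM|Mx] := leP `|x| M; last by rewrite suppM// normr0.
by apply: cmax; rewrite in_itv/= -ler_norml.
Qed.

Lemma test_fun_integrable psi : test_fun psi -> mu.-integrable setT (EFin \o psi).
Proof.
move=> tpsi; have [C [M [C0 M0 leC suppM]]] := test_fun_bounded tpsi.
apply: (@le_integrable _ _ _ mu _ measurableT _ (EFin \o (fun x => C * \1_(`[- M, M]) x))).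
- by apply/measurable_EFinP; exact: test_fun_measurable.
- move=> x _ /=; rewrite lee_fin [leRHS]ger0_norm ?mulr_ge0//.
  rewrite indicE; case: (boolP (x \in _)) => [_|]; first by rewrite mulr1.
  rewrite notin_setE/= in_itv/= -ler_norml => /negP; rewrite -ltNge => /suppM ->.
  by rewrite normr0 mulr0.
- have /= := @integrableZl _ _ _ mu _ measurableT C _
    (@integrable_indic_itv _ (- M) M true false).
  by under eq_fun do rewrite -EFinM.
Qed.

(** A primitive [P] of [psi] is in general not compactly supported, but [P w - P (w - s)] is: beyond
    [M + s] the whole window misses the support of [psi]. *)
Lemma test_fun_window psi (s : R) : 0 < s -> test_fun psi ->
  let B := fun w => \int[mu]_(z in `]w - s, w]) psi z in
  test_fun B /\ derive1 B = (fun w => psi w - psi (w - s)).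
Proof.
move=> s0 tpsi B.
have [C [M [C0 M0 leC suppM]]] := test_fun_bounded tpsi.
have ipsi := test_fun_integrable tpsi.
have iS (D : set R) : measurable D -> mu.-integrable D (EFin \o psi).
  by move=> mD; exact: (integrableS measurableT).
pose P x := \int[mu]_(z in `]-oo, x]) psi z.
have dP (x : R) : is_derive x (1 : R) P (psi x).
  have xu : x < x + 1 by rewrite ltrDl.
  have Nyx : ((-oo%O : itv_bound R) < BRight x)%E by rewrite ltNyr.
  have [dPx Px] := @continuous_FTC1 _ psi -oo%O x (x + 1) xu (iS _ (measurable_itv _)) Nyx
    (@test_fun_continuous _ tpsi x).
  by split; [exact: dPx|rewrite -derive1E; exact: Px].
have BE : B = (fun w => P w - P (w - s)).
  apply/funext => w; rewrite /B /P Rintegral_itvB//.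
  + exact: iS.
  + by rewrite bnd_simp gerBl ltW.
have dB (w : R) : is_derive w (1 : R) B ((fun w => psi w - psi (w - s)) w).
  rewrite BE.
  have dc : is_derive w (1 : R) (P \o (fun w => w - s)) (psi (w - s) * 1).
    by apply: is_derive1_comp; exact: is_derive_shift.
  by apply: (is_derive_eq (is_deriveB (dP w) dc)); rewrite mulr1.
have [derB B'] := is_derive_fun dB.
split; last exact: B'.
split.
  apply: smoothI; first exact: derB.
  rewrite B'.
  have spsi : smooth psi := tpsi.1.
  exact: (smoothB spsi (@smooth_shift _ _ (- s) spsi)).
exists (M + s) => w Mw; rewrite /B (@eq_Rintegral _ _ _ _ _ (cst 0)); last first.
  move=> z; rewrite inE/= in_itv/= => /andP[wz zw]; apply: suppM.
  have [w0|w0] := ltP w 0.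
    rewrite ltr0_norm; last exact: le_lt_trans w0.
    by move: Mw; rewrite ltr0_norm//; lra.
  move: Mw; rewrite ger0_norm// => Mw.
  by apply: (lt_le_trans _ (ler_norm _)); lra.
by rewrite Rintegral_cst// mul0r.
Qed.

(** On []a, b[] this is [exp (- 1 / (n.+1 * (x - a)))] times its mirror image at [b]. It tends to 1
    there while staying below the indicator, which is then the majorant for dominated convergence.
    The arguments are expanded to the affine form of [Clos_affine]. *)
Definition smooth_bump (a b : R) (n : nat) (x : R) : R :=
  flat 0 (n.+1%:R * x + - n.+1%:R * a) * flat 0 (- n.+1%:R * x + n.+1%:R * b).

Lemma flat0_itv x : 0 <= flat 0 x <= (1 : R).
Proof.
rewrite /flat; case: ifP => x0; last by rewrite lexx ler01.
by rewrite expr0 mul1r expR_ge0/= expR_le1 oppr_le0 invr_ge0 ltW.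
Qed.

Lemma bump_ge0 a b n x : 0 <= smooth_bump a b n x.
Proof.
by rewrite mulr_ge0//; [have /andP[] := flat0_itv (n.+1%:R * x + - n.+1%:R * a)
  |have /andP[] := flat0_itv (- n.+1%:R * x + n.+1%:R * b)].
Qed.

Lemma bump_le_indic a b n x : smooth_bump a b n x <= \1_(`]a, b[) x.
Proof.
rewrite indicE; case: (boolP (x \in _)) => [_|].
  have /andP[? ?] := flat0_itv (n.+1%:R * x + - n.+1%:R * a).
  by have /andP[? ?] := flat0_itv (- n.+1%:R * x + n.+1%:R * b); rewrite mulr_ile1.
rewrite notin_setE/= in_itv/= => /negP; rewrite negb_and -!leNgt => /orP[xa|bx].
  by rewrite /smooth_bump /flat ifF ?mul0r// mulNr -mulrBr pmulr_rgt0// subr_gt0 ltNge xa.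
rewrite /smooth_bump mulrC /flat ifF ?mul0r// mulNr addrC -mulrBr pmulr_rgt0//.
by rewrite subr_gt0 ltNge bx.
Qed.

Lemma test_fun_bump a b n : test_fun (smooth_bump a b n).
Proof.
split.
  by apply/smooth_closureP/Clos_mul; apply: Clos_affine; exact: Clos_flat.
exists (Num.max `|a| `|b|) => x; rewrite gt_max => /andP[xa xb].
apply/eqP; rewrite eq_le bump_ge0 andbT (le_trans (bump_le_indic _ _ _ _))//.
rewrite indicE memNset// => /=; rewrite in_itv/= => /andP[ax xb'].
have [x0|x0] := leP 0 x.
  by move: xb; rewrite (ger0_norm x0) => /(le_lt_trans (ler_norm b)); rewrite ltNge ltW.
move: xa; rewrite (ltr0_norm x0) -normrN => /(le_lt_trans (ler_norm _)).
by rewrite ltrN2 ltNge ltW.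
Qed.

Lemma bump_cvg a b x : smooth_bump a b n x @[n --> \oo] --> (\1_(`]a, b[) x : R).
Proof.
have flat_cvg (c : R) : 0 < c -> flat 0 (n.+1%:R * c) @[n --> \oo] --> (1 : R).
  move=> c0; rewrite (_ : (fun n => _) = (fun n => expR (- (n.+1%:R^-1 * c^-1)))); last first.
    by apply/funext => n; rewrite /flat mulr_gt0// expr0 mul1r invfM.
  rewrite -[X in _ --> X]expR0; apply: continuous_cvg; first exact: continuous_expR.
  rewrite -oppr0; apply: cvgN; rewrite -(mul0r c^-1); apply: cvgM; last exact: cvg_cst.
  exact: cvg_harmonic.
rewrite indicE; case: (boolP (x \in _)) => [|xab].
  rewrite inE/= in_itv/= => /andP[ax xb].
  rewrite -[X in _ --> X]mulr1; apply: cvgM.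
    under eq_fun do rewrite mulNr -mulrBr; apply: flat_cvg; by rewrite subr_gt0.
  under eq_fun do rewrite mulNr addrC -mulrBr; apply: flat_cvg; by rewrite subr_gt0.
rewrite (_ : (fun n => _) = cst 0); first exact: cvg_cst.
apply/funext => n; apply/eqP; rewrite eq_le bump_ge0 andbT.
by rewrite (le_trans (bump_le_indic _ _ _ _))// indicE (negbTE xab).
Qed.

End test_functions.

(** * The fundamental lemma of the calculus of variations in the plane *)

Section open_rectangles.
Context {R : realType}.
Local Notation T := (measurableTypeR R).

Definition open_itvs : set (set T) := @RGenOpens.G R.

Definition open_rects : set (set (T * T)) :=
  [set A `*` B | A in open_itvs & B in open_itvs].

Lemma open_itvs_measurableE : @measurable _ T = <<s open_itvs >>.
Proof. exact: RGenOpens.measurableE. Qed.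

Lemma open_itvsI : setI_closed open_itvs.
Proof.
move=> _ _ [a [b ->]] [c [d ->]]; exists (Num.max a c), (Num.min b d).
apply/seteqP; split => x /=; rewrite !in_itv/= gt_max lt_min.
  by move=> [/andP[-> ->] /andP[-> ->]].
by move=> /andP[/andP[-> ->] /andP[-> ->]].
Qed.

Lemma bigcup_open_itvs : \bigcup_(n : nat) (`](- n%:R), n%:R[%classic : set T) = setT.
Proof.
apply/seteqP; split => // x _.
exists (Num.bound `|x|) => //=.
rewrite in_itv/= -ltr_norml.
by rewrite archi_boundP.
Qed.

(** The sides are enlarged from open intervals to measurable sets one at a time. Each enlargement
    needs a full strip [setT * B] or [A * setT], available because the line is a countable union of
    open intervals. *)
Lemma open_rects_measurableE :
  @measurable _ (T * T)%type = <<s open_rects >>.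
Proof.
have sE := smallest_sigma_algebra setT open_rects.
pose S : set (set (T * T)) := <<s open_rects >>.
have [S0 SC SU] := sE.
have SI A B : S A -> S B -> S (A `&` B).
  move=> SA SB; rewrite -(setCK A) -(setCK B) -setCU -setTD; apply: (SC).
  rewrite -bigcup2E; apply: (SU) => -[|[|n]] //=; rewrite -setTD; exact: (SC).
have SD A B : S A -> S B -> S (A `\` B).
  by move=> SA SB; rewrite setDE; apply: SI => //; rewrite -setTD; exact: (SC).
have itvn n : open_itvs (`](- n%:R), n%:R[%classic : set T).
  by exists (- n%:R), n%:R.
have S1 (B : set T) : open_itvs B -> forall A : set T, measurable A -> S (A `*` B).
  move=> oB; rewrite open_itvs_measurableE.
  have SG (A : set T) : open_itvs A -> S (A `*` B).
    by move=> oA; apply: sub_sigma_algebra; exists A => //; exists B.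
  have STB : S (setT `*` B).
    by rewrite -bigcup_open_itvs setX_bigcupl; apply: (SU) => n; exact: SG.
  suff sub : <<s open_itvs >> `<=` [set A : set T | S (A `*` B)] by exact: sub.
  apply: smallest_sub => //.
  split=> /=.
  - by rewrite set0X; exact: S0.
  - move=> A SAB; rewrite (_ : (setT `\` A) `*` B = (setT `*` B) `\` (A `*` B)).
      exact: SD.
    by apply/seteqP; split => -[x y] /=; tauto.
  - by move=> F SF; rewrite setX_bigcupl; exact: (SU).
have S2 (A : set T) : measurable A -> forall B : set T, measurable B -> S (A `*` B).
  move=> mA; rewrite open_itvs_measurableE.
  have SAT : S (A `*` setT).
    rewrite -[X in _ `*` X]bigcup_open_itvs setX_bigcupr.
    by apply: (SU) => n; exact: S1.
  suff sub : <<s open_itvs >> `<=` [set B : set T | S (A `*` B)] by exact: sub.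
  apply: smallest_sub; last first.
    by move=> B oB; exact: S1.
  split=> /=.
  - by rewrite setX0; exact: S0.
  - move=> B SAB; rewrite (_ : A `*` (setT `\` B) = (A `*` setT) `\` (A `*` B)).
      exact: SD.
    by apply/seteqP; split => -[x y] /=; tauto.
  - by move=> F SF; rewrite setX_bigcupr; exact: (SU).
rewrite measurable_prod_measurableType; apply/seteqP; split.
  apply: smallest_sub => //.
  by move=> _ [A mA [B mB <-]]; exact: S2.
apply: smallest_sub; first exact: smallest_sigma_algebra.
move=> _ [_ [a [b ->]] [_ [c [d ->]] <-]]; apply: sub_sigma_algebra.
by exists `]a, b[%classic => //; exists `]c, d[%classic.
Qed.

Lemma open_rectsI : setI_closed open_rects.
Proof.
move=> _ _ [A oA [B oB <-]] [C oC [D oD <-]]; rewrite -setXI.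
exists (A `&` C); first exact: open_itvsI.
by exists (B `&` D) => //; exact: open_itvsI.
Qed.

End open_rectangles.

Section integral_pi_system.
Local Open Scope ereal_scope.
Context d (T : measurableType d) (R : realType).
Variable m : {measure set T -> \bar R}.

(** Dynkin's theorem: the sets on which the integral vanishes form a lambda-system. The vanishing of
    the total integral gives the complements, integrability the countable disjoint unions. *)
Lemma integral_eq0_pi_system (f : T -> \bar R) (G : set (set T)) :
  @measurable _ T = <<s G >> -> setI_closed G -> m.-integrable setT f ->
  \int[m]_x f x = 0 -> (forall A, G A -> \int[m]_(x in A) f x = 0) ->
  forall A, measurable A -> \int[m]_(x in A) f x = 0.
Proof.
move=> GE GI fi f0 fG A; rewrite GE.
apply: (@dynkin_induction _ _ G (fun A => \int[m]_(x in A) f x = 0)) => //.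
- move=> S mS fS.
  have : \int[m]_(x in S `|` ~` S) f x = 0 by rewrite setUv.
  rewrite integral_setU ?fS ?add0e//.
  + exact: measurableC.
  + by rewrite setUv; exact: (measurable_int m).
  + by rewrite disj_set2E setICr.
- move=> F mF tF fF; rewrite integral_bigcup//.
  + by rewrite eseries0// => n _ _; exact: fF.
  + apply: (integrableS measurableT) => //; exact: bigcup_measurable.
Qed.

End integral_pi_system.

(** * Changes of variables by translations and by exchange of coordinates *)

Section measure_preserving.
Local Open Scope ereal_scope.
Context d (X : measurableType d) (R : realType).
Variable m : {measure set X -> \bar R}.
Variable phi : X -> X.

Definition measure_preserving := measurable_fun setT phi /\
  forall A, measurable A -> m (phi @^-1` A) = m A.

Hypothesis mp : measure_preserving.

Let integral_pushforwardE (f : X -> \bar R) :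
  \int[pushforward m phi]_x f x = \int[m]_x f x.
Proof.
apply: eq_measure_integral; first exact: mp.1.
by move=> mphi A mA _; rewrite -[RHS]mp.2.
Qed.

Lemma ge0_integral_preserving (f : X -> \bar R) : measurable_fun setT f ->
  (forall x, 0 <= f x) -> \int[m]_x f (phi x) = \int[m]_x f x.
Proof.
move=> mf f0; rewrite -[RHS]integral_pushforwardE.
by rewrite (ge0_integral_pushforward mp.1)// => x _; exact: f0.
Qed.

Lemma integrable_preserving (f : X -> \bar R) : m.-integrable setT f ->
  m.-integrable setT (f \o phi).
Proof.
move=> /integrableP[mf foo]; apply/integrableP; split.
  by apply: measurableT_comp => //; exact: mp.1.
rewrite (@ge0_integral_preserving (fun x => `|f x|))//.
exact: measurableT_comp.
Qed.

Lemma integral_preserving (f : X -> \bar R) : m.-integrable setT f ->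
  \int[m]_x f (phi x) = \int[m]_x f x.
Proof.
move=> fi; rewrite -[RHS]integral_pushforwardE.
rewrite (integral_pushforward mp.1)//; first exact: (measurable_int m).
by rewrite preimage_setT; exact: integrable_preserving.
Qed.

End measure_preserving.

Section plane.
Context {R : realType}.
Local Notation mu := (@lebesgue_measure R).
Local Notation mu2 := (mu \x mu)%E.
Implicit Types (e psi : R -> R) (f g : R * R -> R).

Lemma measure_preserving_shift (s : R) :
  measure_preserving mu (fun x : R => x + s).
Proof.
have ms : measurable_fun setT (fun x : R => x + s) by exact: measurable_funD.
split=> // A mA.
apply/esym; apply: (@lebesgue_measure_unique R (pushforward mu (fun x : measurableTypeR R => x + s : measurableTypeR R))) => // _ [[a b] _ <-].
transitivity (mu `](a - s), (b - s)]%classic); last first.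
  rewrite /pushforward; congr (mu _).
  by apply/seteqP; split=> x /=; rewrite !in_itv/= lerBrDr ltrBlDr.
rewrite !lebesgue_measure_itv/= !lte_fin ltrD2r; case: ifPn => // _.
by rewrite -!EFinB; congr EFin; ring.
Qed.

Lemma measure_preserving_shift2 (s : R) :
  measure_preserving mu2 (fun p : R * R => (p.1, p.2 + s)).
Proof.
have ms : measurable_fun setT (fun p : R * R => (p.1, p.2 + s)).
  apply: measurable_fun_pair => //=.
  by apply: measurable_funD.
split=> // A mA; apply/esym.
apply: (@product_measure_unique _ _ _ _ R mu mu (pushforward mu2 (fun p : measurableTypeR R * measurableTypeR R => (p.1, p.2 + s) : measurableTypeR R * measurableTypeR R))) => //.
move=> B C mB mC; transitivity (mu2 (B `*` ((fun x => x + s) @^-1` C))) => //.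
have [ms1 mps] := measure_preserving_shift s.
rewrite product_measure1E ?mps// -[X in measurable X]setTI; exact: ms1.
Qed.

Lemma measure_preserving_swap :
  measure_preserving mu2 (fun p : R * R => (p.2, p.1)).
Proof.
have ms : measurable_fun setT (fun p : R * R => (p.2, p.1)).
  exact: measurable_fun_pair.
split=> // A mA; apply/esym.
apply: (@product_measure_unique _ _ _ _ R mu mu (pushforward mu2 (fun p : measurableTypeR R * measurableTypeR R => (p.2, p.1) : measurableTypeR R * measurableTypeR R))) => //.
move=> B C mB mC; transitivity (mu2 (C `*` B)).
  by rewrite /pushforward; congr (mu2 _); apply/seteqP; split=> -[x y] []/=.
by rewrite product_measure1E// muleC.
Qed.

End plane.

(** * Locally integrable functions and the weights they are tested on *)

Section locally_integrable_plane.
Context {R : realType}.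
Local Notation mu := (@lebesgue_measure R).
Local Notation mu2 := (mu \x mu)%E.
Local Notation T := (measurableTypeR R).
Implicit Types (e psi : R -> R) (f g : R * R -> R).

(** Bounded with compact support: a class containing both the test functions and the indicators of
    intervals that they approximate. *)
Definition bcs (k : R -> R) := measurable_fun setT k /\ exists C M : R,
  [/\ 0 <= C, 0 <= M, forall x, `|k x| <= C & forall x, M < `|x| -> k x = 0].

Definition cutoff (N : R) (p : R * R) : R := \1_(`[- N, N]) p.1 * \1_(`[- N, N]) p.2.

(** Local integrability survives multiplication by a coordinate, which square integrability does
    not; the product [z * phi] requires this. *)
Definition Lloc f := measurable_fun setT f /\ forall N : R,
  mu2.-integrable setT (fun p => (f p * cutoff N p)%:E).

Lemma test_fun_bcs psi : test_fun psi -> bcs psi.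
Proof. by move=> tpsi; split; [exact: test_fun_measurable|exact: test_fun_bounded]. Qed.

Lemma bcs_indic (N : R) : bcs \1_(`[- N, N]).
Proof.
split=> //; exists 1, `|N|; split=> // x.
  by rewrite indicE; case: (_ \in _); rewrite ?normr1 ?normr0.
move=> Nx; rewrite indicE memNset//= in_itv/= -ler_norml.
by apply/negP; rewrite -ltNge (le_lt_trans (ler_norm _)).
Qed.

Lemma bcs_shift psi (s : R) : bcs psi -> bcs (fun x => psi (x + s)).
Proof.
move=> [mpsi [C [M [C0 M0 leC sM]]]]; split.
  by apply: measurableT_comp => //; exact: measurable_funD.
exists C, (M + `|s|); split=> //; first by rewrite addr_ge0.
move=> x Msx; apply: sM; rewrite -(ltrD2r `|s|) (lt_le_trans Msx)//.
by rewrite -{1}(addrK s x) (le_trans (ler_normB _ _)).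
Qed.

Lemma tensor_measurable e psi : measurable_fun setT e -> measurable_fun setT psi ->
  measurable_fun setT (fun p : R * R => e p.1 * psi p.2).
Proof.
move=> me mpsi; apply: measurable_funM.
  by apply: (measurableT_comp me); exact: measurable_fst.
by apply: (measurableT_comp mpsi); exact: measurable_snd.
Qed.

Lemma cutoff_measurable N : measurable_fun setT (cutoff N).
Proof. exact: tensor_measurable. Qed.

Lemma cutoff_ge0 N p : 0 <= cutoff N p.
Proof. by rewrite mulr_ge0. Qed.

Lemma cutoff_itv N p : cutoff N p = (`|p.1| <= N)%R%:R * (`|p.2| <= N)%R%:R.
Proof. by rewrite /cutoff !indicE !mem_setE !in_itv/= !ler_norml. Qed.

Lemma bcs_tensor_le e psi : bcs e -> bcs psi -> exists C N : R,
  0 <= C /\ forall p : R * R, `|e p.1 * psi p.2| <= C * cutoff N p.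
Proof.
move=> [me [C [M [C0 M0 leC sM]]]] [mpsi [C' [M' [C'0 M'0 leC' sM']]]].
exists (C * C'), (Num.max M M'); split; first by rewrite mulr_ge0.
move=> [x z]; rewrite cutoff_itv/= normrM !le_max.
have [xM|/sM ->] := leP `|x| M; last by rewrite normr0 mul0r !mulr_ge0.
have [zM|/sM' ->] := leP `|z| M'; last by rewrite normr0 mulr0 !mulr_ge0.
by rewrite orbT !mulr1 ler_pM.
Qed.

Lemma Lloc_integrable f e psi : Lloc f -> bcs e -> bcs psi ->
  mu2.-integrable setT (fun p => (f p * (e p.1 * psi p.2))%:E).
Proof.
move=> [mf fi] be bpsi; have [C [N [C0 le]]] := bcs_tensor_le be bpsi.
apply: (@le_integrable _ _ _ mu2 _ measurableT _
  (fun p => C%:E * (f p * cutoff N p)%:E)%E).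
- apply/measurable_EFinP/measurable_funM => //.
  by apply: tensor_measurable; [exact: be.1|exact: bpsi.1].
- move=> p _; rewrite -EFinM lee_fin (mulrCA C) !(normrM (f p)) ler_wpM2l//.
  by rewrite (le_trans (le p))// ler_norm.
- by apply: integrableZl => //; exact: fi.
Qed.

Lemma LlocP f : measurable_fun setT f ->
  (forall e psi, bcs e -> bcs psi ->
    mu2.-integrable setT (fun p => (f p * (e p.1 * psi p.2))%:E)) -> Lloc f.
Proof. by move=> mf fi; split => // N; apply: fi; exact: bcs_indic. Qed.

Lemma LlocB f g : Lloc f -> Lloc g -> Lloc (fun p => f p - g p).
Proof.
move=> lf lg; apply: LlocP; first exact: measurable_funB lf.1 lg.1.
move=> e psi be bpsi.
have /= := integrableB measurableT (Lloc_integrable lf be bpsi) (Lloc_integrable lg be bpsi).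
by apply: eq_integrable => // p _; rewrite -EFinB mulrBl.
Qed.

Lemma Lloc_shift f (s : R) : Lloc f -> Lloc (fun p => f (p.1, p.2 + s)).
Proof.
move=> lf; have [ms _] := measure_preserving_shift2 s.
apply: LlocP; first exact: (measurableT_comp lf.1 ms).
move=> e psi be bpsi.
have := integrable_preserving (measure_preserving_shift2 s)
  (Lloc_integrable lf be (bcs_shift (- s) bpsi)).
by apply: eq_integrable => // p _ /=; rewrite addrK.
Qed.

Lemma cutoff_integrable N : mu2.-integrable setT (fun p => (cutoff N p)%:E).
Proof.
apply/integrableP; split; first by apply/measurable_EFinP; exact: cutoff_measurable.
rewrite (eq_integral (fun p : T * T => (\1_(`[- N, N] `*` `[- N, N]) p)%:E)); last first.
  move=> p _; rewrite gee0_abs ?lee_fin ?cutoff_ge0//; congr EFin.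
  by rewrite /cutoff !indicE in_setX -natrM mulnb.
rewrite integral_indic//; last exact: measurableX.
rewrite setIT/= product_measure1E//= !lebesgue_measure_itv/=.
by case: ifP => _; rewrite ?mule0 ?ltry// -EFinB -EFinM ltry.
Qed.

(** On a square, which has finite measure, [|f| <= |f|^2 + 1]. *)
Lemma L2_Lloc f : L2 f -> Lloc f.
Proof.
move=> [mf foo]; split=> // N.
have mf2 : measurable_fun setT (fun p => `|f p| ^+ 2).
  by apply: measurable_funX; exact: measurableT_comp.
apply: (@le_integrable _ _ _ mu2 _ measurableT _
  (fun p => (`|f p| ^+ 2)%:E + (cutoff N p)%:E)%E).
- by apply/measurable_EFinP/measurable_funM => //; exact: cutoff_measurable.
- move=> p _; rewrite -EFinD lee_fin normrM (ger0_norm (cutoff_ge0 _ _)).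
  rewrite [leRHS]ger0_norm; last by rewrite addr_ge0 ?cutoff_ge0 ?exprn_ge0.
  rewrite cutoff_itv; case: (_ <= N); case: (_ <= N);
    rewrite /= ?(mulr1n, mulr0n, mul0r, mulr0, mulr1, addr0) ?exprn_ge0//.
  have := sqr_ge0 (`|f p| - 1); have := normr_ge0 (f p); nra.
- apply: integrableD => //; last exact: cutoff_integrable.
  apply/integrableP; split; first by apply/measurable_EFinP.
  apply: le_lt_trans foo; rewrite le_eqVlt; apply/orP; left; apply/eqP.
  by apply: eq_integral => p _; rewrite gee0_abs// lee_fin exprn_ge0.
Qed.

End locally_integrable_plane.

(** * From vanishing against tensor products to vanishing almost everywhere *)

Section fundamental_lemma.
Context {R : realType}.
Local Notation mu := (@lebesgue_measure R).
Local Notation mu2 := (mu \x mu)%E.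
Local Notation T := (measurableTypeR R).

Lemma bcs_indic_oo (a b : R) : bcs \1_(`]a, b[).
Proof.
split=> //; exists 1, (Num.max `|a| `|b|); split=> //.
- by move=> x; rewrite indicE; case: (_ \in _); rewrite ?normr1 ?normr0.
- move=> x xab; rewrite indicE memNset// => /=; rewrite in_itv/= => /andP[ax xb'].
  move: xab; rewrite gt_max => /andP[xa xb].
  have [x0|x0] := leP 0 x.
    by move: xb; rewrite (ger0_norm x0) => /(le_lt_trans (ler_norm b)); rewrite ltNge ltW.
  move: xa; rewrite (ltr0_norm x0) -normrN => /(le_lt_trans (ler_norm _)).
  by rewrite ltrN2 ltNge ltW.
Qed.

Variable D : R * R -> R.
Hypothesis lD : Lloc D.
Hypothesis D0 : forall e psi, test_fun e -> test_fun psi ->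
  (\int[mu2]_p (D p * (e p.1 * psi p.2))%:E = 0)%E.

Let integral_open_rect a b c d :
  (\int[mu2]_p (D p * (\1_(`]a, b[) p.1 * \1_(`]c, d[) p.2))%:E = 0)%E.
Proof.
have mD := lD.1.
have iD := Lloc_integrable lD (bcs_indic_oo a b) (bcs_indic_oo c d).
pose f_ n (p : T * T) := (D p * (smooth_bump a b n p.1 * smooth_bump c d n p.2))%:E.
pose f (p : T * T) := (D p * (\1_(`]a, b[) p.1 * \1_(`]c, d[) p.2))%:E.
have mf_ n : measurable_fun setT (f_ n).
  apply/measurable_EFinP/measurable_funM => //.
  by apply: tensor_measurable; apply: test_fun_measurable; exact: test_fun_bump.
have ff : {ae mu2, forall x, setT x -> f_ ^~ x @ \oo --> f x}.
  apply: aeW => p _; apply: cvg_EFin; first by apply: nearW.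
  by apply: cvgM; [exact: cvg_cst|apply: cvgM; exact: bump_cvg].
have fle : {ae mu2, forall x n, setT x -> (`|f_ n x| <= (abse \o f) x)%E}.
  apply: aeW => p n _; rewrite /f_ /f /= lee_fin !(normrM (D p)) ler_wpM2l//.
  rewrite (normrM (smooth_bump _ _ _ _)) (normrM (\1_(`]a, b[) p.1)) ler_pM//.
    by rewrite ger0_norm ?bump_ge0// (le_trans (bump_le_indic _ _ _ _))// ler_norm.
  by rewrite ger0_norm ?bump_ge0// (le_trans (bump_le_indic _ _ _ _))// ler_norm.
have [_ _ /=] := dominated_convergence measurableT mf_ (measurable_int _ iD) ff
  (integrable_abse iD) fle.
have -> : (fun n => \int[mu2]_x f_ n x)%E = cst 0%E.
  by apply/funext => n; apply: D0; exact: test_fun_bump.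
move=> /cvg_lim <-//.
by rewrite lim_cst.
Qed.

Lemma Lloc_ae0 : {ae mu2, forall p, D p = 0}.
Proof.
have mD := lD.1.
(* Truncating to an open square makes [D] integrable on the whole plane, and an open rectangle cut
   by the square is again an open rectangle. *)
pose Dn (n : nat) (p : T * T) :=
  (D p * (\1_(`](- n%:R), n%:R[) p.1 * \1_(`](- n%:R), n%:R[) p.2))%:E.
have iDn n : mu2.-integrable setT (Dn n).
  by apply: Lloc_integrable => //; exact: bcs_indic_oo.
have Dn0 n A : measurable A -> (\int[mu2]_(p in A) Dn n p = 0)%E.
  apply: (integral_eq0_pi_system open_rects_measurableE open_rectsI) => //.
  - exact: integral_open_rect.
  - move=> _ [A' oA [B' oB <-]].
    have [a [b ab]] : open_itvs (A' `&` `](- n%:R), n%:R[).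
      by apply: open_itvsI => //; exists (- n%:R), n%:R.
    have [c [d cd]] : open_itvs (B' `&` `](- n%:R), n%:R[).
      by apply: open_itvsI => //; exists (- n%:R), n%:R.
    rewrite integral_mkcond -[RHS](integral_open_rect a b c d).
    apply: eq_integral => p _; rewrite -ab -cd patchE in_setX /Dn !indicE !in_setI.
    case: (p.1 \in A'); case: (p.2 \in B') => //=; by rewrite ?(mul0r, mulr0).
have aeDn : {ae mu2, forall p n, Dn n p = 0%E}.
  apply: ae_foralln => n.
  have := @integral_ae_eq _ _ _ mu2 _ measurableT (cst 0%E) _ (iDn n) (measurable_cst _).
  move=> H; have {}H := H (fun E _ mE => etrans (Dn0 n E mE) (esym (integral0 _ _))).
  by apply: filterS H => p; apply.
apply: filterS aeDn => p /(_ (Num.bound (Num.max `|p.1| `|p.2|))).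
have /archi_boundP : 0 <= Num.max `|p.1| `|p.2| by rewrite le_max normr_ge0.
set n := Num.bound _; rewrite gt_max => /andP[p1 p2] [].
rewrite !indicE !mem_set ?mulr1//= in_itv/= -ltr_norml//.
Qed.

End fundamental_lemma.

(** * Window integrals and difference identities for weak derivatives *)

Section area.
Context {R : realType}.
Local Notation mu := (@lebesgue_measure R).
Local Notation T := (measurableTypeR R).

(* an alias of the product measure carrying the sigma-finite structure *)
Definition area : set (T * T) -> \bar R := (mu \x mu)%E.

HB.instance Definition _ := Measure.on area.

Lemma sigma_finite_area : sigma_finite setT area.
Proof.
exists (fun n => `](- n%:R), n%:R[ `*` `](- n%:R), n%:R[).
  rewrite -setXTT -(@bigcup_open_itvs R) predeqE => -[x y]; split.
    move=> [/= [n _ nx] [k _ ky]]; exists (maxn n k) => //; split => /=.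
      apply: subset_itvW nx; by rewrite ?lerN2 ler_nat leq_maxl.
    apply: subset_itvW ky; by rewrite ?lerN2 ler_nat leq_maxr.
  by move=> [n _ []/= ? ?]; split; exists n.
move=> k; split; first exact: measurableX.
rewrite /area product_measure1E//= !lebesgue_measure_itv/=.
by case: ifP => _; rewrite ?mule0 ?ltry// -EFinB -EFinM ltry.
Qed.

HB.instance Definition _ := @Measure_isSigmaFinite.Build _ _ _ area sigma_finite_area.

End area.

Section window.
Context {R : realType}.
Local Notation mu := (@lebesgue_measure R).
Local Notation mu2 := (@area R).
Local Notation mu3 := (mu2 \x mu)%E.
Local Notation T := (measurableTypeR R).
Implicit Types (e psi : R -> R) (f g : R * R -> R).

Lemma measurable_fun_natbool d (X : measurableType d) (b : X -> bool) :
  measurable_fun setT b -> measurable_fun setT (fun x => (b x)%:R : R).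
Proof.
move=> mb; rewrite (_ : (fun x => _) = \1_(b @^-1` [set true])).
  by apply: measurable_indic; rewrite -[X in measurable X]setTI; exact: mb.
by apply/funext => x; rewrite indicE; case bx: (b x); [rewrite mem_set|rewrite memNset//= bx].
Qed.

(** With points written [((x, z), w)], [w] being the window variable, this exchange encodes Fubini's
    theorem in [(z, w)] at fixed [x]. *)
Definition swap23 (q : (R * R) * R) : (R * R) * R := ((q.1.1, q.2), q.1.2).

Lemma swap23K : involutive swap23. Proof. by move=> [[x y] z]. Qed.

Lemma measurable_swap23 : measurable_fun setT swap23.
Proof.
apply: measurable_fun_pair => /=.
  apply: measurable_fun_pair => //=.
  exact: (measurableT_comp measurable_fst measurable_fst).
exact: (measurableT_comp measurable_snd measurable_fst).
Qed.

Let ge0_integral_iter3 (K : (T * T) * T -> \bar R) :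
  measurable_fun setT K -> (forall q, 0 <= K q)%E ->
  (\int[mu3]_q K q = \int[mu]_x \int[mu]_z \int[mu]_w K ((x, z), w))%E.
Proof.
move=> mK K0.
have F0 (p : T * T) : (0 <= fubini_F mu K p)%E by apply: integral_ge0 => w _.
have mF := measurable_fun_fubini_tonelli_F (m2 := mu) K mK K0.
have h1 := fubini_tonelli1 (m1 := mu2) (m2 := mu) K mK K0.
have h2 := fubini_tonelli1 (m1 := mu) (m2 := mu) (fubini_F mu K) mF F0.
exact: etrans h1 h2.
Qed.

Lemma measure_preserving_swap23 : measure_preserving mu3 swap23.
Proof.
split=> [|A mA]; first exact: measurable_swap23.
have mB : measurable (swap23 @^-1` A).
  by rewrite -[X in measurable X]setTI; exact: measurable_swap23.
have iE (B : set ((T * T) * T)) : measurable B ->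
    mu3 B = (\int[mu]_x \int[mu]_z \int[mu]_w (\1_B ((x, z), w))%:E)%E.
  move=> mB'; apply: (etrans _ (@ge0_integral_iter3 (fun q => (\1_B q)%:E) _ _)).
  - by rewrite integral_indic// setIT.
  - by apply/measurable_EFinP; exact: measurable_indic.
  - by move=> q; rewrite lee_fin.
apply: (etrans (iE _ mB)); apply: (etrans _ (esym (iE _ mA))).
apply: eq_integral => x _.
rewrite (@fubini_tonelli _ _ T T R mu mu (fun p : T * T => (\1_A ((x, p.1), p.2))%:E))/=.
- by apply: eq_integral => w _; apply: eq_integral => z _.
- have mi : measurable_fun setT (\1_A : (T * T) * T -> R) by exact: measurable_indic.
  apply/measurable_EFinP; apply: (measurableT_comp mi).
  apply: measurable_fun_pair => //=; apply: measurable_fun_pair => //=.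
- by move=> p; rewrite lee_fin.
Qed.

(** A real-valued integral: it is 0 by default where the integral along the line is infinite. For
    locally integrable [g] this concerns only a null set. *)
Definition win (s : R) g (p : R * R) : R :=
  \int[mu]_(w in `[p.2, p.2 + s[) g (p.1, w).

(** The kernel of [win]. The half-open ends make it, as a function of [z], the indicator of []w - s,
    w]], which is the interval of [test_fun_window]. *)
Definition inwin (s z w : R) : R := ((z <= w) && (w < z + s))%:R.

Lemma inwin_indicl s z w : inwin s z w = \1_(`[z, z + s[) w.
Proof. by rewrite indicE mem_setE in_itv. Qed.

Lemma inwin_indicr s z w : inwin s z w = \1_(`]w - s, w]) z.
Proof. by rewrite indicE mem_setE in_itv/= /inwin ltrBlDr andbC. Qed.

Lemma measurable_inwin d (X : measurableType d) (s : R) (a b : X -> R) :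
  measurable_fun setT a -> measurable_fun setT b ->
  measurable_fun setT (fun x => inwin s (a x) (b x)).
Proof.
move=> ma mb; apply: measurable_fun_natbool; apply: measurable_and.
  exact: measurable_fun_ler.
by apply: measurable_fun_ltr => //; exact: measurable_funD.
Qed.

Lemma measurable_line d (X : measurableType d) g (a b : X -> R) :
  measurable_fun setT g -> measurable_fun setT a -> measurable_fun setT b ->
  measurable_fun setT (fun x => g (a x, b x)).
Proof. by move=> mg ma mb; apply: (measurableT_comp mg); exact: measurable_fun_pair. Qed.

Lemma winE s g p :
  win s g p = fine (\int[mu]_w (g (p.1, w) * inwin s p.2 w)%:E)%E.
Proof.
rewrite /win /Rintegral integral_mkcond; congr fine.
apply: eq_integral => w _; rewrite patchE inwin_indicl indicE.
by case: (_ \in _); rewrite ?mulr1 ?mulr0.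
Qed.

Lemma measurable_win_kernel s g : measurable_fun setT g -> measurable_fun setT
  (fun q : (T * T) * T => (g (q.1.1, q.2) * inwin s q.1.2 q.2)%:E).
Proof.
move=> mg; apply/measurable_EFinP/measurable_funM.
  apply: measurable_line => //; exact: (measurableT_comp measurable_fst measurable_fst).
apply: measurable_inwin => //; exact: (measurableT_comp measurable_snd measurable_fst).
Qed.

Lemma measurable_win s g : measurable_fun setT g -> measurable_fun setT (win s g).
Proof.
move=> mg; rewrite (_ : win s g = fun p =>
  fine (\int[mu]_w (g (p.1, w) * inwin s p.2 w)%:E)%E); last first.
  by apply/funext => p; rewrite winE.
apply: (measurableT_comp (fine_measurable measurableT)) => //.
(* The integrand has no sign and need not be integrable, so Tonelli's measurability is applied to
   its positive and negative parts. *)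
under eq_fun do rewrite integralE.
have mK := measurable_win_kernel s mg.
apply: emeasurable_funB.
  have H := measurable_fun_fubini_tonelli_F (m2 := mu) _ (measurable_funepos mK)
    (funepos_ge0 _).
  apply: eq_measurable_fun H => p _; apply: eq_integral => w _.
  by rewrite !funeposE.
have H := measurable_fun_fubini_tonelli_F (m2 := mu) _ (measurable_funeneg mK)
  (funeneg_ge0 _).
apply: eq_measurable_fun H => p _; apply: eq_integral => w _.
by rewrite !funenegE.
Qed.

End window.

Section window_duality.
Context {R : realType}.
Local Notation mu := (@lebesgue_measure R).
Local Notation mu2 := (@area R).
Local Notation mu3 := (mu2 \x mu)%E.
Local Notation T := (measurableTypeR R).
Variables (s : R) (g : R * R -> R) (e psi : R -> R).
Hypotheses (s0 : 0 <= s) (lg : Lloc g) (be : bcs e) (bpsi : bcs psi).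

Let K (q : (T * T) * T) : \bar R :=
  (g (q.1.1, q.2) * inwin s q.1.2 q.2 * (e q.1.1 * psi q.1.2))%:E.

Let mK : measurable_fun setT K.
Proof.
apply/measurable_EFinP/measurable_funM.
  by apply/measurable_EFinP; exact: (measurable_win_kernel s lg.1).
by apply: (measurableT_comp (tensor_measurable be.1 bpsi.1)).
Qed.

(** In the order [((x, w), z)] the function [g] depends on the first pair only, so the majorant [F]
    splits into a locally truncated [|g|] and an indicator in [z]. *)
Let iKswap : mu3.-integrable setT (K \o swap23).
Proof.
have [me [C [M [C0 M0 leC sM]]]] := be.
have [mpsi [C' [M' [C'0 M'0 leC' sM']]]] := bpsi.
(* For [|z| <= M'] the window starting at [z] stays in [|w| <= M' + s]. *)
pose N := Num.max M (M' + s).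
pose F (q : (T * T) * T) := ((C * C') * (`|g q.1 * cutoff N q.1| * \1_(`[- N, N]) q.2))%:E.
have mF : measurable_fun setT F.
  apply/measurable_EFinP/measurable_funM => //.
  have mi : measurable_fun setT (\1_(`[- N, N]) : T -> R) by exact: measurable_indic.
  have mgc : measurable_fun setT (fun p : T * T => g p * cutoff N p).
    exact: measurable_funM lg.1 (cutoff_measurable N).
  apply: measurable_funM; last exact: (measurableT_comp mi measurable_snd).
  by apply: measurableT_comp => //; exact: (measurableT_comp mgc measurable_fst).
apply: (@le_integrable _ _ _ mu3 _ measurableT _ F).
- exact: (measurableT_comp mK measurable_swap23).
- move=> [[x w] z] _; rewrite /K /F /= lee_fin.
  rewrite [leRHS]ger0_norm; last by rewrite !mulr_ge0.
  rewrite cutoff_itv/= !normrM !normr_nat indicE mem_setE in_itv/= -ler_norml !le_max.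
  have [xM|/sM ->] := leP `|x| M; last by rewrite normr0 mul0r mulr0 !mulr_ge0.
  have [zM|/sM' ->] := leP `|z| M'; last by rewrite normr0 !mulr0 !mulr_ge0.
  case: andP => [[zw wz]|_]; last by rewrite mulr0 mul0r !mulr_ge0.
  rewrite orTb (_ : (`|z| <= M' + s)%R); last by rewrite (le_trans zM)// lerDl.
  rewrite (_ : (`|w| <= M' + s)%R); last first.
    by move: zM; rewrite !ler_norml => /andP[? ?]; apply/andP; split; lra.
  by rewrite !orbT /= !mulr1 [leRHS]mulrC ler_wpM2l// ler_pM.
- apply/(integrable12ltyP mu2 mu mF).
  have /integrableP[_ goo] := lg.2 N.
  have iG := integrable_abse (lg.2 N).
  pose k := ((C * C') * fine (mu `[- N, N]%classic))%:E.
  rewrite [ltLHS](_ : _ = \int[mu2]_p (k * `|(g p * cutoff N p)%:E|))%E.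
    rewrite ge0_integralZl//.
    + apply: lte_mul_pinfty; [|by []|exact: goo].
      by rewrite lee_fin mulr_ge0 ?mulr_ge0// fine_ge0.
    + exact: (measurable_int _ iG).
    + by rewrite lee_fin mulr_ge0 ?mulr_ge0// fine_ge0.
  apply: eq_integral => p _.
  rewrite (eq_integral (fun z : T => ((C * C') * `|g p * cutoff N p|)%:E * (\1_(`[- N, N]) z)%:E)%E); last first.
    by move=> z _; rewrite /F /= -EFinM ger0_norm ?mulrA// !mulr_ge0.
  rewrite ge0_integralZl//; last 2 first.
  + by apply/measurable_EFinP.
  + by rewrite lee_fin !mulr_ge0.
  rewrite integral_indic// setIT /= /k -[X in (_ * X)%E]fineK; last first.
    rewrite lebesgue_measure_itv/=; by case: ifP.
  by rewrite -!EFinM; congr EFin; rewrite mulrAC.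
Qed.

Let iK : mu3.-integrable setT K.
Proof.
have := integrable_preserving (@measure_preserving_swap23 R) iKswap.
by apply: eq_integrable => // q _; rewrite /= swap23K.
Qed.

Let inner_win :
  {ae mu2, forall p, fubini_F mu K p = (win s g p * (e p.1 * psi p.2))%:E}.
Proof.
apply: filterS (ae_integrable1 iK) => p iKp.
rewrite /fubini_F winE; set c := e p.1 * psi p.2.
(* Where [c] vanishes the slice of [g] may fail to be integrable, but both sides are 0. Elsewhere
   its integrability over the window follows from that of the slice of [K] on division by [c]. *)
have [c0|c0] := eqVneq c 0.
  by rewrite c0 mulr0 integral0_eq// => w _; rewrite /K/= -/c c0 mulr0.
pose k (w : T) := (g (p.1, w) * inwin s p.2 w)%:E.
have ik : mu.-integrable setT k.
  have := integrableZl measurableT c^-1 iKp.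
  apply: eq_integrable => // w _.
  by rewrite /K /k /= -EFinM -/c mulrC mulfK.
rewrite (eq_integral (fun w => c%:E * k w)%E); last first.
  by move=> w _; rewrite /K /k /= -/c -EFinM mulrC.
rewrite integralZl// [in RHS]mulrC.
transitivity (c%:E * (fine (\int[mu]_w k w))%:E)%E => //.
by rewrite fineK//; exact: integrable_fin_num.
Qed.

Lemma integrable_win_tensor :
  mu2.-integrable setT (fun p => (win s g p * (e p.1 * psi p.2))%:E).
Proof.
have mw : measurable_fun setT (fun p : T * T => (win s g p * (e p.1 * psi p.2))%:E).
  apply/measurable_EFinP/measurable_funM; first exact: (measurable_win s lg.1).
  exact: tensor_measurable be.1 bpsi.1.
have /integrableP[mF Foo] := integrable_fubini_F iK.
apply/integrableP; split=> //; apply: le_lt_trans Foo; rewrite le_eqVlt; apply/orP; left.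
apply/eqP/ae_eq_integral => //; [exact: measurableT_comp|exact: measurableT_comp|].
by apply: filterS inner_win => p /= -> _.
Qed.

(** The adjoint of integration over the forward window [[z, z + s[] is integration over the backward
    window []w - s, w]]. *)
Lemma integral_win_tensor : test_fun psi ->
  (\int[mu2]_p (win s g p * (e p.1 * psi p.2))%:E =
   \int[mu2]_p (g p * (e p.1 * \int[mu]_(z in `]p.2 - s, p.2]) psi z)%R)%:E)%E.
Proof.
move=> tpsi; transitivity (\int[mu2]_p fubini_F mu K p)%E.
  apply: ae_eq_integral => //.
  - exact: measurable_int integrable_win_tensor.
  - exact: measurable_int (integrable_fubini_F iK).
  - by apply: filterS inner_win => p /= -> _.
rewrite (integral12_prod_meas1 iK) -(integral_preserving (@measure_preserving_swap23 R) iK).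
rewrite -(integral12_prod_meas1 iKswap); apply: eq_integral => p _.
pose J : set T := `]((p.2 : R) - s), (p.2 : R)]%classic.
rewrite /fubini_F/= (eq_integral (fun z : T => (g p * e p.1)%:E * ((EFin \o psi) \_ J) z)%E); last first.
  move=> z _; rewrite /K /= patchE inwin_indicr indicE -surjective_pairing /J.
  by case: (_ \in _); rewrite ?mule0 ?mulr0 ?mul0r// mulr1 -EFinM mulrA.
have ipsi : mu.-integrable J (EFin \o psi).
  apply: (integrableS measurableT _ _ (test_fun_integrable tpsi)) => //.
  exact: measurable_itv.
have mJ : measurable J by exact: measurable_itv.
rewrite integralZl//; last by apply/integrable_restrict => //; rewrite setTI.
rewrite -integral_mkcond [in RHS]mulrA.
transitivity ((g p * e p.1)%:E * (fine (\int[mu]_(z in J) (EFin \o psi) z))%:E)%E => //.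
by rewrite fineK//; exact: integrable_fin_num.
Qed.

End window_duality.

(** * First and second differences of weakly differentiable functions *)

Section weak_derivatives.
Context {R : realType}.
Local Notation mu := (@lebesgue_measure R).
Local Notation mu2 := (@area R).
Local Notation T := (measurableTypeR R).
Implicit Types (e psi : R -> R) (f g k phi h : R * R -> R).

Lemma Lloc_win g (s : R) : 0 <= s -> Lloc g -> Lloc (win s g).
Proof.
move=> s0 lg; apply: LlocP; first exact: (measurable_win s lg.1).
by move=> e psi be bpsi; exact: integrable_win_tensor.
Qed.

Lemma test_fun_shift psi (s : R) : test_fun psi -> test_fun (fun x => psi (x + s)).
Proof.
move=> [spsi [M sM]]; split; first exact: smooth_shift.
exists (M + `|s|) => x Mx; apply: sM; rewrite -(ltrD2r `|s|) (lt_le_trans Mx)//.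
by rewrite -{1}(addrK s x) (le_trans (ler_normB _ _)).
Qed.

Lemma derive1_shift psi (s : R) : test_fun psi ->
  derive1 (fun x => psi (x + s)) = (fun x => derive1 psi (x + s)).
Proof.
move=> [spsi _].
have H (x : R) : is_derive x (1 : R) (fun x => psi (x + s))
    ((fun x => derive1 psi (x + s)) x).
  have d1 : is_derive (x + s) (1 : R) psi (derive1 psi (x + s)) by exact: smooth_is_derive.
  have d2 : is_derive x (1 : R) (fun x : R => x + s) 1 by exact: is_derive_shift.
  apply: (is_derive_eq (@is_derive1_comp _ psi (fun x : R => x + s) x _ 1 d1 d2)).
  by rewrite mulr1.
by have [_ ->] := is_derive_fun H.
Qed.

Lemma test_fun_derive1 psi : test_fun psi -> test_fun (derive1 psi).
Proof.
move=> [spsi [M sM]]; split; first exact: smooth_derive1.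
exists M => x Mx; rewrite derive1E.
rewrite (@near_eq_derive _ _ _ psi (cst 0)); first exact: derive_cst.
have Mnear : \forall y \near x, M < `|y| :> R.
  have c : (fun y : R => `|y|) @ x --> `|x| by exact: norm_continuous.
  by near=> y; near: y; exact: (cvgr_gt _ c _ Mx).
by apply: filterS Mnear => y; exact: sM.
Unshelve. all: by end_near. Qed.

Let iD f g e psi : Lloc f -> Lloc g -> bcs e -> bcs psi ->
  (\int[mu2]_p ((f p - g p) * (e p.1 * psi p.2))%:E =
   \int[mu2]_p (f p * (e p.1 * psi p.2))%:E - \int[mu2]_p (g p * (e p.1 * psi p.2))%:E)%E.
Proof.
move=> lf lg be bpsi.
have fi := Lloc_integrable lf be bpsi.
have gi := Lloc_integrable lg be bpsi.
rewrite -(@integralB_EFin _ _ _ mu2)//; apply: eq_integral => p _.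
by rewrite -EFinB mulrBl.
Qed.

Let ishift f e psi (s : R) : Lloc f -> bcs e -> bcs psi ->
  (\int[mu2]_p (f (p.1, p.2 + s)%R * (e p.1 * psi p.2))%:E =
   \int[mu2]_p (f p * (e p.1 * psi (p.2 - s)%R))%:E)%E.
Proof.
move=> lf be bpsi.
have fi := Lloc_integrable lf be (bcs_shift (- s) bpsi).
rewrite -[RHS](integral_preserving (measure_preserving_shift2 s) fi).
by apply: eq_integral => p _ /=; rewrite addrK.
Qed.

Let ifin f e psi : Lloc f -> bcs e -> bcs psi ->
  (\int[mu2]_p (f p * (e p.1 * psi p.2))%:E)%E \is a fin_num.
Proof. by move=> lf be bpsi; apply: integrable_fin_num => //; exact: Lloc_integrable. Qed.

Lemma weak_dz_diff f g (s : R) : 0 < s -> Lloc f -> Lloc g -> weak_dz f g ->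
  {ae mu2, forall p : T * T, f (p.1, p.2 + s) - f p = win s g p}.
Proof.
move=> s0 lf lg wfg.
have lw := Lloc_win (ltW s0) lg.
have ls := Lloc_shift s lf.
have lD := LlocB (LlocB ls lf) lw.
suff H : {ae mu2, forall p : T * T, f (p.1, p.2 + s) - f p - win s g p = 0}.
  by apply: filterS H => p /eqP; rewrite subr_eq0 => /eqP.
apply: (Lloc_ae0 lD) => e psi te tpsi.
have be := test_fun_bcs te; have bpsi := test_fun_bcs tpsi.
have [tB B'] := test_fun_window s0 tpsi.
(* With [B] as test function the left side already contains the difference of [psi]; moving the
   translation back to [f] gives the increment of [f], and duality turns the right side into
   [win s g]. *)
have := wfg e _ te tB; rewrite B' => wB.
have iwB : (\int[mu2]_p (f p * (e p.1 * (psi p.2 - psi (p.2 - s))))%:E =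
   \int[mu2]_p (f p * (e p.1 * psi p.2))%:E -
   \int[mu2]_p (f p * (e p.1 * psi (p.2 - s)%R))%:E)%E.
  have i1 := Lloc_integrable lf be bpsi.
  have i2 := Lloc_integrable lf be (bcs_shift (- s) bpsi).
  rewrite -(@integralB_EFin _ _ _ mu2)//; apply: eq_integral => p _.
  by rewrite -EFinB -mulrBr -mulrBr.
have ww := integral_win_tensor (ltW s0) lg be bpsi tpsi.
have key := etrans (etrans (esym iwB) wB) (congr1 oppe (esym ww)).
have i1 := iD (LlocB ls lf) lw be bpsi.
have i2 := iD ls lf be bpsi.
have i3 := ishift s lf be bpsi.
apply: (etrans i1); rewrite i2 i3.
have f1 := ifin lf be bpsi.
have f2 := ifin lf be (bcs_shift (- s) bpsi).
have f3 := ifin lw be bpsi.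
move: key; rewrite -(fineK f1) -(fineK f2) -(fineK f3) -!EFinB -EFinN => -[key].
by congr EFin; move: key; lra.
Qed.

Lemma weak_dz_shiftB f g (s : R) : Lloc f -> Lloc g -> weak_dz f g ->
  weak_dz (fun p => f (p.1, p.2 + s) - f p) (fun p => g (p.1, p.2 + s) - g p).
Proof.
move=> lf lg wfg e psi te tpsi.
have tpsis := test_fun_shift (- s) tpsi.
have be := test_fun_bcs te; have bpsi := test_fun_bcs tpsi.
have bpsi' := test_fun_bcs (test_fun_derive1 tpsi).
have i1 := iD (Lloc_shift s lf) lf be bpsi'.
have i2 := iD (Lloc_shift s lg) lg be bpsi.
apply: (etrans i1); rewrite -[RHS]/(- _)%E; apply: (etrans _ (congr1 oppe (esym i2))).
have w1 := wfg e psi te tpsi.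
have w2 := wfg e _ te tpsis; rewrite derive1_shift// in w2.
rewrite (ishift s lf be bpsi') (ishift s lg be bpsi).
apply: (etrans (congr2 (fun a b => a - b)%E w2 w1)).
have f1 := ifin lg be bpsi.
have f2 := ifin lg be (bcs_shift (- s) bpsi).
rewrite -(fineK f1) -(fineK f2) -!EFinN -!EFinD; congr EFin; ring.
Qed.

Lemma weak_dz_ae f g k : Lloc g -> Lloc k -> {ae mu2, forall p : T * T, g p = k p} ->
  weak_dz f g -> weak_dz f k.
Proof.
move=> lg lk gk wfg e psi te tpsi; rewrite (wfg e psi te tpsi); congr (- _)%E.
have be := test_fun_bcs te; have bpsi := test_fun_bcs tpsi.
apply: ae_eq_integral => //.
- exact: (measurable_int _ (Lloc_integrable lg be bpsi)).
- exact: (measurable_int _ (Lloc_integrable lk be bpsi)).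
- by apply: filterS gk => p -> _.
Qed.

(** The first difference of [f] has as weak derivative the first difference of [g], which is
    [win s k] almost everywhere; the first-order identity then applies a second time. *)
Lemma weak_dz_diff2 f g k (s : R) : 0 < s -> Lloc f -> Lloc g -> Lloc k ->
  weak_dz f g -> weak_dz g k ->
  {ae mu2, forall p : T * T,
    f (p.1, p.2 + s + s) - 2 * f (p.1, p.2 + s) + f p = win s (win s k) p}.
Proof.
move=> s0 lf lg lk wfg wgk.
have lw := Lloc_win (ltW s0) lk.
have lsf := LlocB (Lloc_shift s lf) lf.
have lsg := LlocB (Lloc_shift s lg) lg.
have w := weak_dz_ae lsg lw (weak_dz_diff s0 lg lk wgk) (weak_dz_shiftB s lf lg wfg).
have := weak_dz_diff s0 lsf lw w.
by apply: filterS => p /= <-; ring.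
Qed.

Lemma Lloc_swap f : Lloc f -> Lloc (fun p => f (p.2, p.1)).
Proof.
move=> lf; apply: LlocP.
  by apply: (measurableT_comp lf.1); exact: measurable_fun_pair.
move=> e psi be bpsi.
have := integrable_preserving measure_preserving_swap (Lloc_integrable lf bpsi be).
by apply: eq_integrable => // p _ /=; rewrite (mulrC (e _)).
Qed.

Lemma Lloc_mulx f : Lloc f -> Lloc (fun p => p.1 * f p).
Proof.
move=> lf; apply: LlocP.
  by apply: measurable_funM; [exact: measurable_fst|exact: lf.1].
move=> e psi be bpsi.
have bxe : bcs (fun x => x * e x).
  have [me [C [M [C0 M0 leC sM]]]] := be; split; first exact: measurable_funM.
  exists (M * C), M; split=> // [|x|x /sM ->]; rewrite ?mulr0//; first exact: mulr_ge0.
  rewrite normrM; have [xM|/sM ->] := leP `|x| M; first exact: ler_pM.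
  by rewrite normr0 mulr0 mulr_ge0.
have := Lloc_integrable lf bxe bpsi.
by apply: eq_integrable => // p _ /=; congr EFin; ring.
Qed.

(** The factor [z] commutes with [d_x], so [h] is [d_x (z * phi)]. Exchanging the coordinates makes
    this a derivative in the second variable, and [weak_dz_diff] serves for both directions. *)
Lemma weak_z_dx_swap phi h : Lloc phi -> Lloc h -> weak_z_dx phi h ->
  weak_dz (fun p => p.1 * phi (p.2, p.1)) (fun p => h (p.2, p.1)).
Proof.
move=> lphi lh w e psi te tpsi.
have be := test_fun_bcs te; have bpsi := test_fun_bcs tpsi.
have bpsi' := test_fun_bcs (test_fun_derive1 tpsi).
have i1 := Lloc_integrable (Lloc_mulx (Lloc_swap lphi)) be bpsi'.
have i2 := Lloc_integrable (Lloc_swap lh) be bpsi.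
rewrite -[LHS](integral_preserving measure_preserving_swap i1).
rewrite -[X in _ = (- X)%E](integral_preserving measure_preserving_swap i2).
apply: etrans; last apply: etrans (w psi e tpsi te) _.
  by apply: eq_integral => p _ /=; rewrite -surjective_pairing; congr EFin; ring.
by congr (- _)%E; apply: eq_integral => p _ /=; rewrite -surjective_pairing; congr EFin; ring.
Qed.

Lemma weak_z_dx_diff phi h (t : R) : 0 < t -> Lloc phi -> Lloc h -> weak_z_dx phi h ->
  {ae mu2, forall p : T * T,
    p.1 * (phi (p.2 + t, p.1) - phi (p.2, p.1)) = win t (fun q => h (q.2, q.1)) p}.
Proof.
move=> t0 lphi lh w.
have := weak_dz_diff t0 (Lloc_mulx (Lloc_swap lphi)) (Lloc_swap lh) (weak_z_dx_swap lphi lh w).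
by apply: filterS => p /= <-; rewrite mulrBr.
Qed.

End weak_derivatives.

(** * Integral estimates *)

Section power_integrals.
Context {R : realType}.
Local Notation mu := (@lebesgue_measure R).
Local Notation T := (measurableTypeR R).

Lemma integral_powR_itv (q a b : R) : 0 < a -> a <= b -> q != 0 ->
  (\int[mu]_(t in `[a, b]) (t `^ (q - 1))%:E = ((b `^ q - a `^ q) / q)%:E)%E.
Proof.
move=> a0; rewrite le_eqVlt => /predU1P[<-|ab] q0.
  by rewrite set_itv1 integral_set1 subrr mul0r.
have pos t : t \in `[a, b] -> 0 < t.
  by rewrite in_itv/= => /andP[at_ _]; exact: lt_le_trans at_.
pose F (t : R) : R := t `^ q / q.
have dF (t : R) : 0 < t -> is_derive t (1 : R) F (t `^ (q - 1)).
  move=> t0; have d1 := is_derive1_powR q t0.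
  have := is_deriveZ q^-1 d1; rewrite /GRing.scale/= mulKf//.
  rewrite (_ : q^-1 \*: _ = F)//; apply/funext => x; rewrite /F mulrC//.
have cF (t : R) : 0 < t -> {for t, continuous F}.
  by move=> t0; apply/differentiable_continuous/derivable1_diffP; have [] := dF _ t0.
rewrite (@continuous_FTC2 _ _ F)//; first by rewrite -EFinB /F mulrBl.
- apply: derivable_within_continuous => t /pos t0.
  by apply: derivable_powR; rewrite in_itv/= t0.
- split.
  + by move=> t tab; have [] := dF t (pos _ (subset_itv_oo_cc tab)).
  + by apply: cvg_at_right_filter; exact: cF.
  + by apply: cvg_at_left_filter; apply: cF; exact: lt_trans ab.
- move=> t tab; rewrite derive1E.
  by have [_ ->] := dF t (pos _ (subset_itv_oo_cc tab)).
Qed.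

Lemma measurable_powR_EFin (q : R) (D : set T) : measurable_fun D (fun t : T => (t `^ q)%:E).
Proof. by apply/measurable_EFinP; apply: measurable_funTS; exact: measurable_powR. Qed.

(** The power integrals meet a singularity at 0 or an infinite end. On [[1/(n+1), n+1]] a primitive
    is available, and a bound uniform in [n] passes to the monotone limit. *)
Lemma integral_exhaustion (D : set T) (f : T -> \bar R) (C : \bar R) :
  measurable D -> D `<=` [set x : R | 0 < x] -> measurable_fun D f ->
  (forall x, D x -> (0 <= f x)%E) ->
  (forall n, (\int[mu]_(x in D `&` `[(n.+1%:R^-1)%R, (n.+1%:R)%R]%classic) f x <= C)%E) ->
  (\int[mu]_(x in D) f x <= C)%E.
Proof.
move=> mD D0 mf f0 leC.
pose F n : set T := D `&` `[n.+1%:R^-1, n.+1%:R]%classic.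
have UF : \bigcup_n F n = D.
  apply/seteqP; split=> [x [n _ []]//|x Dx].
  have x0 := D0 _ Dx.
  have xy := @archi_boundP R (Num.max x x^-1).
  have /xy : 0 <= Num.max x x^-1 by rewrite le_max (ltW x0).
  rewrite gt_max => /andP[x1 x2].
  exists (Num.bound (Num.max x x^-1)) => //; split=> //=; rewrite in_itv/=.
  rewrite -[X in _ <= X <= _]invrK lef_pV2 ?posrE ?invr_gt0//.
  by rewrite invrK (le_trans (ltW x2)) ?(le_trans (ltW x1))// ler_nat.
have mF n : measurable (F n) by apply: measurableI.
have cF : (\int[mu]_(x in F i) f x @[i --> \oo] --> \int[mu]_(x in \bigcup_i F i) f x)%E.
  apply: ge0_nondecreasing_set_cvg_integral => //.
  - move=> n m nm; apply/subsetPset; apply: setIS => x /=; rewrite !in_itv/= => /andP[nx xn].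
    by rewrite (le_trans _ nx) ?(le_trans xn)// ?ler_nat// lef_pV2 ?posrE// ler_nat.
  - by move=> n; apply: measurable_funS mf => //; exact: subIsetl.
  - by move=> n x [Dx _]; exact: f0.
rewrite -UF -(cvg_lim _ cF)//; apply: lime_le; first by apply/cvg_ex; eexists; exact: cF.
by apply: nearW => n; exact: leC.
Qed.

Lemma integral_powR_near0 (q a : R) : 0 < q -> 0 <= a ->
  (\int[mu]_(t in `]0%R, a]) (t `^ (q - 1))%:E <= (a `^ q / q)%:E)%E.
Proof.
move=> q0 a0; apply: integral_exhaustion => //.
- by move=> x /=; rewrite in_itv/= => /andP[].
- exact: measurable_powR_EFin.
- by move=> x _; rewrite lee_fin powR_ge0.
move=> n; have [na|an] := leP n.+1%:R^-1 a; last first.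
  rewrite (_ : _ `&` _ = set0) ?integral_set0 ?lee_fin ?divr_ge0 ?powR_ge0 ?ltW//.
  apply/seteqP; split=> // x [/=]; rewrite !in_itv/= => /andP[_ xa] /andP[nx _].
  by have := lt_le_trans an (le_trans nx xa); rewrite ltxx.
apply: (@le_trans _ _ (\int[mu]_(t in `[(n.+1%:R^-1)%R, a]) (t `^ (q - 1))%:E)%E).
  apply: ge0_subset_integral => //.
  - exact: measurableI.
  - exact: measurable_powR_EFin.
  - by move=> x _; rewrite lee_fin powR_ge0.
  - by move=> x [/=]; rewrite !in_itv/= => /andP[_ ->] /andP[->].
rewrite integral_powR_itv ?gt_eqF// lee_fin ler_pM2r ?invr_gt0//.
by rewrite lerBlDr lerDl powR_ge0.
Qed.

Lemma integral_powR_tail (q a : R) : 0 < q -> 0 < a ->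
  (\int[mu]_(t in `[a, +oo[) (t `^ (- q - 1))%:E <= (a `^ (- q) / q)%:E)%E.
Proof.
move=> q0 a0; apply: integral_exhaustion => //.
- by move=> x /=; rewrite in_itv/= andbT; exact: lt_le_trans.
- exact: measurable_powR_EFin.
- by move=> x _; rewrite lee_fin powR_ge0.
move=> n; have [na|an] := leP a n.+1%:R; last first.
  rewrite (_ : _ `&` _ = set0) ?integral_set0 ?lee_fin ?divr_ge0 ?powR_ge0 ?ltW//.
  apply/seteqP; split=> // x [/=]; rewrite !in_itv/= andbT => ax /andP[_ xn].
  by have := lt_le_trans an (le_trans ax xn); rewrite ltxx.
apply: (@le_trans _ _ (\int[mu]_(t in `[a, (n.+1%:R)%R]) (t `^ (- q - 1))%:E)%E).
  apply: ge0_subset_integral => //.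
  - exact: measurableI.
  - exact: measurable_powR_EFin.
  - by move=> x _; rewrite lee_fin powR_ge0.
  - by move=> x [/=]; rewrite !in_itv/= andbT => -> /andP[_ ->].
rewrite integral_powR_itv ?oppr_eq0 ?gt_eqF// lee_fin invrN mulrN -mulNr opprB.
by rewrite ler_pM2r ?invr_gt0// lerBlDr lerDl powR_ge0.
Qed.

End power_integrals.

Section cauchy_schwarz.
Local Open Scope ereal_scope.
Context d (X : measurableType d) (R : realType).
Variable m : {measure set X -> \bar R}.
Implicit Types u v : X -> R.

Lemma poweR_half_sq (x : \bar R) : 0 <= x -> x `^ 2^-1 * x `^ 2^-1 = x.
Proof.
have h : (2^-1 + 2^-1 = 1 :> R)%R by lra.
by move=> x0; rewrite -poweRD /poweRD_def h ?oner_eq0// poweRe1.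
Qed.

Lemma Lnorm2E u : 'N[m]_2%:E[EFin \o u] = (\int[m]_x (`|u x| ^+ 2)%:E) `^ 2^-1.
Proof.
rewrite unlock /Lnorm; congr (_ `^ _); apply: eq_integral => x _ /=.
by rewrite powR_mulrn.
Qed.

Lemma cauchy_schwarz u v : measurable_fun setT u -> measurable_fun setT v ->
  (\int[m]_x `|u x * v x|%:E) ^+ 2 <=
  (\int[m]_x (u x ^+ 2)%:E) * (\int[m]_x (v x ^+ 2)%:E).
Proof.
move=> mu mv.
have E w : \int[m]_x (w x ^+ 2)%:E = \int[m]_x (`|w x| ^+ 2)%:E.
  by apply: eq_integral => x _; rewrite real_normK// num_real.
have I0 (w : X -> R) : 0 <= \int[m]_x (`|w x| ^+ 2)%:E.
  by apply: integral_ge0 => x _; rewrite lee_fin exprn_ge0.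
have h : (2^-1 + 2^-1 = 1 :> R)%R by lra.
have := @hoelder _ _ _ m u v 2 2 mu mv (ltr0Sn _ _) (ltr0Sn _ _) h.
rewrite Lnorm1 !Lnorm2E -(poweRM _ (I0 u) (I0 v)) => H.
rewrite (E u) (E v) -[leRHS]poweR_half_sq ?mule_ge0//.
have I1 : 0 <= \int[m]_x `|u x * v x|%:E.
  by apply: integral_ge0 => x _; rewrite lee_fin.
by rewrite expe2; exact: lee_pmul.
Qed.

End cauchy_schwarz.

Section window_bounds.
Context {R : realType}.
Local Notation mu := (@lebesgue_measure R).
Local Notation mu2 := (@area R).
Local Notation T := (measurableTypeR R).
Implicit Types (f g k : R * R -> R).

Lemma inwin_ge0 (s z w : R) : 0 <= inwin s z w.
Proof. by rewrite /inwin. Qed.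

Lemma inwin_sq (s z w : R) : inwin s z w ^+ 2 = inwin s z w.
Proof. by rewrite /inwin; case: (_ && _); rewrite ?expr1n// expr0n. Qed.

Lemma measurable_inwinl (s z : R) : measurable_fun setT (fun w : T => inwin s z w).
Proof. exact: measurable_inwin. Qed.

Lemma measurable_inwinr (s w : R) : measurable_fun setT (fun z : T => inwin s z w).
Proof. exact: measurable_inwin. Qed.

Lemma measurable_slice g (x : R) : measurable_fun setT g ->
  measurable_fun setT (fun w : T => g (x, w)).
Proof. by move=> mg; apply: measurable_line. Qed.

Lemma integral_inwinl (s z : R) : 0 <= s ->
  (\int[mu]_w (inwin s z w)%:E = s%:E)%E.
Proof.
move=> s0; under eq_integral do rewrite inwin_indicl.
rewrite integral_indic// setIT/= lebesgue_measure_itv/= lte_fin.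
rewrite ltrDl; case: ltP => [_|s0'].
  by rewrite -EFinB; congr EFin; ring.
by congr EFin; apply/eqP; rewrite eq_le s0 s0'.
Qed.

Lemma integral_inwinr (s w : R) : 0 <= s ->
  (\int[mu]_z (inwin s z w)%:E = s%:E)%E.
Proof.
move=> s0; under eq_integral do rewrite inwin_indicr.
rewrite integral_indic// setIT/= lebesgue_measure_itv/= lte_fin.
rewrite gtrBl; case: ltP => [_|s0'].
  by rewrite -EFinB; congr EFin; ring.
by congr EFin; apply/eqP; rewrite eq_le s0 s0'.
Qed.

Lemma win_le_abs (s : R) g (p : R * R) : measurable_fun setT g ->
  (`|win s g p|%:E <= \int[mu]_w (`|g (p.1, w)| * inwin s p.2 w)%:E)%E.
Proof.
move=> mg; rewrite winE.
have mk : measurable_fun setT (fun w : T => (g (p.1, w) * inwin s p.2 w)%:E).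
  apply/measurable_EFinP/measurable_funM; first exact: measurable_slice.
  exact: measurable_inwinl.
set I := (\int[mu]_w _)%E.
have le1 : (`|fine I|%:E <= `|I|)%E by case: I => [r| |]//=; rewrite ?normr0 ?leey.
apply: (le_trans le1).
apply: (le_trans (le_abse_integral mu measurableT mk)).
apply: ge0_le_integral => //.
- exact: measurableT_comp.
- apply/measurable_EFinP/measurable_funM; last exact: measurable_inwinl.
  by apply: measurableT_comp => //; exact: measurable_slice.
- by move=> w _; rewrite lee_fin normrM (ger0_norm (inwin_ge0 _ _ _)).
Qed.

(** Cauchy-Schwarz against the indicator of the window. As the indicator equals its square, one copy
    remains next to [g^2] and can later be integrated in the position of the window. *)
Lemma win_sq_le (s : R) g (p : R * R) : 0 <= s -> measurable_fun setT g ->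
  ((win s g p ^+ 2)%:E <= s%:E * \int[mu]_w (g (p.1, w) ^+ 2 * inwin s p.2 w)%:E)%E.
Proof.
move=> s0 mg.
have mg1 : measurable_fun setT (fun w : T => g (p.1, w) * inwin s p.2 w).
  by apply: measurable_funM; [exact: measurable_slice|exact: measurable_inwinl].
have := cauchy_schwarz mu mg1 (measurable_inwinl s p.2).
under [X in (_ <= _ * X)%E]eq_integral do rewrite inwin_sq.
rewrite integral_inwinl// muleC => H.
have -> : (\int[mu]_w (g (p.1, w) ^+ 2 * inwin s p.2 w)%:E =
    \int[mu]_w ((g (p.1, w) * inwin s p.2 w) ^+ 2)%:E)%E.
  by apply: eq_integral => w _; rewrite exprMn inwin_sq.
apply: le_trans H.
rewrite -[X in (X%:E <= _)%E]real_normK ?num_real// EFin_expe expe2 [leRHS]expe2.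
have H := win_le_abs s p mg.
have -> : (\int[mu]_w `|g (p.1, w) * inwin s p.2 w * inwin s p.2 w|%:E =
    \int[mu]_w (`|g (p.1, w)| * inwin s p.2 w)%:E)%E.
  apply: eq_integral => w _; rewrite -mulrA -expr2 inwin_sq normrM.
  by rewrite (ger0_norm (inwin_ge0 _ _ _)).
by apply: lee_pmul => //; rewrite lee_fin.
Qed.

(** One factor [s] comes from Cauchy-Schwarz, the other from Tonelli, since a given [w] lies in the
    windows of a set of [z] of length [s]. The weight depends only on the coordinate that the window
    does not move. *)
Lemma integral_win_sq_le (s : R) g (c : R -> R) : 0 <= s -> measurable_fun setT g ->
  measurable_fun setT c -> (forall x, 0 <= c x) ->
  (\int[mu2]_p (c p.1 * win s g p ^+ 2)%:E <=
   (s ^+ 2)%:E * \int[mu2]_p (c p.1 * g p ^+ 2)%:E)%E.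
Proof.
move=> s0 mg mc c0.
have mcp : measurable_fun setT (fun p : T * T => c p.1).
  by apply: (measurableT_comp mc); exact: measurable_fst.
pose K (q : (T * T) * T) : \bar R :=
  (s * c q.1.1 * (g (q.1.1, q.2) ^+ 2 * inwin s q.1.2 q.2))%:E.
have K0 q : (0 <= K q)%E.
  by rewrite lee_fin mulr_ge0 ?(mulr_ge0 s0)// mulr_ge0 ?sqr_ge0 ?inwin_ge0.
have mK : measurable_fun setT K.
  apply/measurable_EFinP/measurable_funM.
    apply: measurable_funM => //.
    by apply: (measurableT_comp mc); exact: (measurableT_comp measurable_fst measurable_fst).
  apply: measurable_funM.
    apply: measurable_funX; apply: measurable_line => //.
    exact: (measurableT_comp measurable_fst measurable_fst).
  by apply: measurable_inwin => //; exact: (measurableT_comp measurable_snd measurable_fst).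
have F0 (p : T * T) : (0 <= fubini_F mu K p)%E by apply: integral_ge0 => w _; exact: K0.
have mF := measurable_fun_fubini_tonelli_F (m2 := mu) K mK K0.
apply: (@le_trans _ _ (\int[mu2]_p fubini_F mu K p)%E).
  apply: ge0_le_integral => //.
  - by move=> p _; rewrite lee_fin mulr_ge0 ?sqr_ge0.
  - apply/measurable_EFinP/measurable_funM => //.
    by apply: measurable_funX; exact: measurable_win.
  - move=> p _; rewrite /fubini_F.
    rewrite (eq_integral (fun w : T => (c p.1 * s)%:E * (g (p.1, w) ^+ 2 * inwin s p.2 w)%:E)%E); last first.
      by move=> w _; rewrite /K /= -EFinM (mulrC s).
    rewrite ge0_integralZl//; last 3 first.
    + apply/measurable_EFinP/measurable_funM; last exact: measurable_inwinl.
      by apply: measurable_funX; exact: measurable_slice.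
    + by move=> w _; rewrite lee_fin mulr_ge0 ?sqr_ge0 ?inwin_ge0.
    + by rewrite lee_fin mulr_ge0.
    by rewrite (EFinM (c p.1) s) -muleA (EFinM (c p.1)) lee_wpmul2l ?lee_fin//; exact: win_sq_le.
have K0' q : (0 <= (K \o swap23) q)%E by exact: K0.
have mK' : measurable_fun setT (K \o swap23).
  exact: (measurableT_comp mK measurable_swap23).
have h1 := fubini_tonelli1 (m1 := mu2) (m2 := mu) K mK K0.
have h2 := fubini_tonelli1 (m1 := mu2) (m2 := mu) (K \o swap23) mK' K0'.
have h3 := ge0_integral_preserving measure_preserving_swap23 mK K0.
rewrite -h1 -h3 (etrans (erefl _) h2) -ge0_integralZl//; last 3 first.
- by apply/measurable_EFinP/measurable_funM => //; apply: measurable_funX.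
- by move=> p _; rewrite lee_fin mulr_ge0 ?sqr_ge0.
- by rewrite lee_fin sqr_ge0.
rewrite le_eqVlt; apply/orP; left; apply/eqP.
apply: eq_integral => p _; rewrite /fubini_F/=.
rewrite (eq_integral (fun z : T => (s * c p.1 * g p ^+ 2)%:E * (inwin s z p.2)%:E)%E); last first.
  by move=> z _; rewrite /K /= -EFinM mulrA -surjective_pairing.
rewrite ge0_integralZl//; last 3 first.
- by apply/measurable_EFinP; exact: measurable_inwinr.
- by move=> z _; rewrite lee_fin inwin_ge0.
- by rewrite lee_fin mulr_ge0 ?sqr_ge0// mulr_ge0.
by rewrite integral_inwinr// -!EFinM; congr EFin; ring.
Qed.

End window_bounds.

(** * Slabs around the degenerate line [z = 0] *)

Section slab_estimates.
Context {R : realType}.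
Local Notation mu := (@lebesgue_measure R).
Local Notation mu2 := (@area R).
Local Notation T := (measurableTypeR R).
Implicit Types (f g k phi h : R * R -> R).

Lemma measure_preserving_opp : measure_preserving mu (fun x : R => - x).
Proof.
have mN : measurable_fun setT (fun x : R => - x) by exact: oppr_measurable.
by split=> // A mA; have := lebesgue_measureN mA.
Qed.

Lemma measurable_absltr d (X : measurableType d) (a : X -> R) (c : R) :
  measurable_fun setT a -> measurable_fun setT (fun x => (`|a x| < c)%R%:R : R).
Proof.
move=> ma; apply: measurable_fun_natbool; apply: measurable_fun_ltr => //.
exact: measurableT_comp.
Qed.

Lemma measurable_absler d (X : measurableType d) (a : X -> R) (c : R) :
  measurable_fun setT a -> measurable_fun setT (fun x => (c <= `|a x|)%R%:R : R).
Proof.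
move=> ma; apply: measurable_fun_natbool; apply: measurable_fun_ler => //.
exact: measurableT_comp.
Qed.

Lemma measurable_abs_powR d (X : measurableType d) (a : X -> R) (q : R) :
  measurable_fun setT a -> measurable_fun setT (fun x => `|a x| `^ q).
Proof.
by move=> ma; apply: (measurableT_comp (measurable_powR q)); exact: measurableT_comp.
Qed.

Lemma integral_abs_powR (q a : R) : 0 < q -> q < 1 -> 0 <= a ->
  (\int[mu]_w ((`|w| < a)%R%:R * `|w| `^ (q - 1))%:E <= (2 * (a `^ q / q))%:E)%E.
Proof.
move=> q0 q1 a0.
pose f (w : T) := (((0 < w) && (w <= a))%R%:R * w `^ (q - 1))%:E.
have f0 w : (0 <= f w)%E by rewrite lee_fin mulr_ge0 ?powR_ge0.
have mf : measurable_fun setT f.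
  apply/measurable_EFinP/measurable_funM; last exact: measurable_powR.
  apply: measurable_fun_natbool; apply: measurable_and.
    exact: measurable_fun_ltr.
  exact: measurable_fun_ler.
have If : (\int[mu]_w f w <= (a `^ q / q)%:E)%E.
  apply: (le_trans _ (integral_powR_near0 q0 a0)); rewrite [leRHS]integral_mkcond.
  rewrite le_eqVlt; apply/orP; left; apply/eqP/eq_integral => w _.
  rewrite patchE mem_setE in_itv/= /f.
  by case: (_ && _); rewrite ?mul1r ?mul0r.
apply: (@le_trans _ _ (\int[mu]_w (f w + f (- w)%R))%E).
  apply: ge0_le_integral => //.
  - apply/measurable_EFinP/measurable_funM; first exact: measurable_absltr.
    exact: measurable_abs_powR.
  - apply: emeasurable_funD => //; apply: (measurableT_comp mf).
    exact: oppr_measurable.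
  - move=> w _; have [w0|w0|->] := ltrgt0P w.
    + rewrite -[leLHS]adde0 leeD// /f w0/=.
      by have [wa|_] := ltP w a; [rewrite (ltW wa)|rewrite mul0r lee_fin mulr_ge0 ?powR_ge0].
    + rewrite -[leLHS]add0e leeD// /f oppr_gt0 w0/=.
      by have [wa|_] := ltP (- w) a; [rewrite (ltW wa)|rewrite mul0r lee_fin mulr_ge0 ?powR_ge0].
    (* By convention 0 raised to a nonzero exponent is 0, so the singular point contributes nothing;
       [q < 1] excludes the exponent 0. *)
    + rewrite powR0 ?mulr0 ?adde_ge0//.
      by rewrite subr_eq0 lt_eqF.
rewrite ge0_integralD//; last first.
  by apply: (measurableT_comp mf); exact: oppr_measurable.
rewrite (ge0_integral_preserving measure_preserving_opp mf f0).
by rewrite mulr_natl mulr2n EFinD leeD.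
Qed.

(* Hardy's inequality in disguise: the weight [|w|^(1/2)] keeps the later
   integration over the scale [a] scale invariant and convergent. *)
Lemma weighted_slice_bound (a : R) (u : R -> R) : 0 <= a -> measurable_fun setT u ->
  ((\int[mu]_w ((`|w| < a)%R%:R * `|u w|)%:E) ^+ 2 <=
   (4 * a `^ 2^-1)%:E * \int[mu]_w ((`|w| < a)%R%:R * (`|w| `^ 2^-1 * u w ^+ 2))%:E)%E.
Proof.
move=> a0 mu_.
have [h0 h1] : 0 < 2^-1 :> R /\ 2^-1 < 1 :> R by split; lra.
(* The square of [|w|^(-1/4)] has integral at most [4 a^(1/2)] over the slab, which is the constant
   of the statement. *)
pose f (w : T) : R := (`|w| < a)%R%:R * `|w| `^ (- 4^-1).
pose g (w : T) : R := (`|w| < a)%R%:R * (`|w| `^ 4^-1 * u w).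
have mf : measurable_fun setT f.
  by apply: measurable_funM; [exact: measurable_absltr|exact: measurable_abs_powR].
have mg : measurable_fun setT g.
  apply: measurable_funM; first exact: measurable_absltr.
  by apply: measurable_funM => //; exact: measurable_abs_powR.
have bsq (b : bool) : b%:R ^+ 2 = b%:R :> R by case: b; rewrite ?expr1n// expr0n.
have psq (w q : R) : 0 <= w -> q != 0 -> (w `^ q) ^+ 2 = w `^ (q + q).
  by move=> w0 q0; rewrite -powR_mulrn ?powR_ge0// -powRrM mulr_natr mulr2n.
have := cauchy_schwarz mu mf mg.
have -> : (\int[mu]_w `|f w * g w|%:E = \int[mu]_w ((`|w| < a)%R%:R * `|u w|)%:E)%E.
  apply: ae_eq_integral => //.
  - by apply/measurable_EFinP; apply: measurableT_comp => //; exact: measurable_funM.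
  - apply/measurable_EFinP/measurable_funM; first exact: measurable_absltr.
    exact: measurableT_comp.
  (* At [w = 0] both powers are 0 by convention and the product [f * g] misses [|u 0|], so the
     identity holds only off that point. *)
  - exists [set (0 : R)]; split => //; first exact: lebesgue_measure_set1.
    move=> w /=; apply: contra_notP => /eqP w0 _; congr EFin.
    rewrite /f /g mulrACA -expr2 bsq [_ `^ _ * (_ * _)]mulrA -powRD; last first.
      by apply/implyP => _; rewrite normr_eq0.
    by rewrite addNr powRr0 mul1r normrM ger0_norm.
have -> : (\int[mu]_w (g w ^+ 2)%:E =
    \int[mu]_w ((`|w| < a)%R%:R * (`|w| `^ 2^-1 * u w ^+ 2))%:E)%E.
  apply: eq_integral => w _; rewrite /g exprMn bsq exprMn psq//.
  by congr ((_ * (_ `^ _ * _))%:E); lra.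
move=> H; apply: (le_trans H); apply: lee_wpmul2r.
  by apply: integral_ge0 => w _; rewrite lee_fin mulr_ge0// mulr_ge0 ?powR_ge0 ?sqr_ge0.
have -> : (\int[mu]_w (f w ^+ 2)%:E =
    \int[mu]_w ((`|w| < a)%R%:R * `|w| `^ (2^-1 - 1))%:E)%E.
  apply: eq_integral => w _; rewrite /f exprMn bsq psq ?oppr_eq0//.
  by congr ((_ * (_ `^ _))%:E); lra.
apply: (le_trans (integral_abs_powR h0 h1 a0)).
by rewrite lee_fin invrK le_eqVlt; apply/orP; left; apply/eqP; ring.
Qed.

End slab_estimates.

Section difference_estimates.
Context {R : realType}.
Local Notation mu := (@lebesgue_measure R).
Local Notation mu2 := (@area R).
Local Notation T := (measurableTypeR R).
Implicit Types (f g k phi h : R * R -> R).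

(** Starting from [|z| < s0], two successive windows of length [2 * s0] stay in [|v| < 5 * s0]. The
    inner integral is bounded by the one over this slab, uniformly in the position, and the outer
    window contributes its length. *)
Lemma win2_le (s0 : R) k (p : R * R) : 0 < s0 -> measurable_fun setT k ->
  `|p.2| < s0 ->
  (`|win (2 * s0) (win (2 * s0) k) p|%:E <=
   (2 * s0)%:E * \int[mu]_w ((`|w| < 5 * s0)%R%:R * `|k (p.1, w)|)%:E)%E.
Proof.
move=> s00 mk ps; set s := 2 * s0; set M := (\int[mu]_w _)%E.
have s_ge0 : 0 <= s by rewrite mulr_ge0 ?ltW.
have M0 : (0 <= M)%E by apply: integral_ge0 => w _; rewrite lee_fin mulr_ge0.
have mw := measurable_win s mk.
have mkx : measurable_fun setT (fun w : T => `|k (p.1, w)|).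
  by apply: measurableT_comp => //; exact: measurable_slice.
apply: (le_trans (win_le_abs s p mw)).
have -> : (s%:E * M = \int[mu]_w (M * (inwin s p.2 w)%:E))%E.
  rewrite ge0_integralZl//; last 2 first.
  - by apply/measurable_EFinP; exact: measurable_inwinl.
  - by move=> w _; rewrite lee_fin inwin_ge0.
  by rewrite integral_inwinl// muleC.
apply: ge0_le_integral => //.
- by move=> w _; rewrite lee_fin mulr_ge0 ?inwin_ge0.
- apply/measurable_EFinP/measurable_funM; last exact: measurable_inwinl.
  by apply: measurableT_comp => //; exact: measurable_slice.
- by apply: measurable_funeM; apply/measurable_EFinP; exact: measurable_inwinl.
move=> w _; rewrite {1 2}/inwin; case: (boolP (_ && _)) => [/andP[zw wz]|_]; last first.
  by rewrite mulr0 mule0.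
rewrite mulr1 mule1; apply: (le_trans (win_le_abs s (p.1, w) mk)).
apply: ge0_le_integral => //=.
- by move=> v _; rewrite lee_fin mulr_ge0 ?inwin_ge0.
- by apply/measurable_EFinP/measurable_funM => //; exact: measurable_inwinl.
- by apply/measurable_EFinP/measurable_funM => //; exact: measurable_absltr.
move=> v _; rewrite lee_fin mulrC ler_wpM2r// /inwin.
case: (boolP (_ && _)) => [/andP[wv vw]|_]; last by [].
rewrite (_ : (`|v| < 5 * s0)%R)//.
by move: ps; rewrite !ltr_norml => /andP[? ?]; apply/andP; split; rewrite /s in wz vw; lra.
Qed.

Lemma integral_win2_le (s0 : R) k : 0 < s0 -> measurable_fun setT k ->
  (\int[mu2]_p ((`|p.2| < s0)%R%:R * win (2 * s0) (win (2 * s0) k) p ^+ 2)%:E <=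
   (32 * s0 ^+ 3 * (5 * s0) `^ 2^-1)%:E *
   \int[mu2]_p ((`|p.2| < 5 * s0)%R%:R * (`|p.2| `^ 2^-1 * k p ^+ 2))%:E)%E.
Proof.
move=> s00 mk.
pose F (p : T * T) := ((`|p.2| < 5 * s0)%R%:R * (`|p.2| `^ 2^-1 * k p ^+ 2))%:E.
have F0 p : (0 <= F p)%E by rewrite lee_fin mulr_ge0// mulr_ge0 ?powR_ge0 ?sqr_ge0.
have mF : measurable_fun setT F.
  apply/measurable_EFinP/measurable_funM; first by apply: measurable_absltr.
  apply: measurable_funM; last exact: measurable_funX.
  exact: measurable_abs_powR.
pose N x := fubini_F mu F x.
have mN : measurable_fun setT N := measurable_fun_fubini_tonelli_F (m2 := mu) F mF F0.
have N0 x : (0 <= N x)%E by apply: integral_ge0 => w _; exact: F0.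
(* The 16 is [2^2] from the square of [2 * s0] in [win2_le] times the 4 of [weighted_slice_bound];
   the width [2 * s0] of the slab in [z] makes it 32. *)
pose c : R := 16 * s0 ^+ 2 * (5 * s0) `^ 2^-1.
have c0 : 0 <= c by rewrite mulr_ge0 ?powR_ge0// mulr_ge0 ?sqr_ge0.
pose G (p : T * T) := (((`|p.2| < s0)%R%:R)%:E * (c%:E * N p.1))%E.
have G0 p : (0 <= G p)%E by rewrite mule_ge0 ?lee_fin// mule_ge0 ?lee_fin.
have mN1 : measurable_fun setT (fun p : T * T => N p.1).
  by apply: (measurableT_comp mN); exact: measurable_fst.
have mG : measurable_fun setT G.
  apply: emeasurable_funM; first by apply/measurable_EFinP; apply: measurable_absltr.
  exact: measurable_funeM.
apply: (@le_trans _ _ (\int[mu2]_p G p)%E).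
  apply: ge0_le_integral => //.
  - by move=> p _; rewrite lee_fin mulr_ge0 ?sqr_ge0.
  - apply/measurable_EFinP/measurable_funM; first by apply: measurable_absltr.
    by apply: measurable_funX; apply: measurable_win; exact: measurable_win.
  move=> p _; rewrite /G; have [ps|_] := ltP `|p.2| s0; last by rewrite mul0r mul0e.
  rewrite mul1r mul1e.
  rewrite -[X in (X%:E <= _)%E]real_normK ?num_real// EFin_expe expe2.
  have H := win2_le s00 mk ps.
  set M := (\int[mu]_w _)%E in H.
  have M0 : (0 <= M)%E by apply: integral_ge0 => w _; rewrite lee_fin mulr_ge0.
  apply: (@le_trans _ _ (((2 * s0)%:E * M) * ((2 * s0)%:E * M))%E).
    by apply: lee_pmul => //; rewrite lee_fin.
  rewrite muleACA -expe2.
  have mkx : measurable_fun setT (fun w : T => k (p.1, w)) by exact: measurable_slice.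
  have s5 : 0 <= 5 * s0 by rewrite mulr_ge0 ?ltW.
  have W := weighted_slice_bound s5 mkx.
  have c2 : (0 <= (2 * s0)%:E * (2 * s0)%:E)%E by rewrite -EFinM lee_fin -expr2 sqr_ge0.
  apply: (le_trans (lee_wpmul2l c2 W)); rewrite muleA -!EFinM.
  rewrite le_eqVlt; apply/orP; left; apply/eqP; congr (_%:E * _)%E.
  by rewrite /c; ring.
have h1 := fubini_tonelli1 (m1 := mu) (m2 := mu) G mG G0.
have h2 := fubini_tonelli1 (m1 := mu) (m2 := mu) F mF F0.
rewrite (etrans (erefl _) h1) (etrans (erefl _) h2).
rewrite -ge0_integralZl//; last first.
  by rewrite lee_fin mulr_ge0 ?powR_ge0// mulr_ge0// exprn_ge0 ?ltW.
rewrite le_eqVlt; apply/orP; left; apply/eqP; apply: eq_integral => x _.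
rewrite /fubini_F /G/=.
rewrite ge0_integralZr//; last 2 first.
- by apply/measurable_EFinP; apply: measurable_absltr.
- by rewrite mule_ge0 ?lee_fin.
have -> : (\int[mu]_z ((`|z| < s0)%R%:R)%:E = (2 * s0)%:E)%E.
  rewrite (eq_integral (fun z : T => (\1_(`](- s0), s0[) z)%:E)); last first.
    by move=> z _; rewrite indicE mem_setE in_itv/= ltr_norml.
  rewrite integral_indic// setIT/= lebesgue_measure_itv/= lte_fin.
  rewrite ifT; last by lra.
  by rewrite -EFinB; congr EFin; ring.
by rewrite muleA -EFinM; congr (_%:E * _)%E; rewrite /c; ring.
Qed.

End difference_estimates.

(** * Increments in [x] and the embedding *)

Section increments.
Context {R : realType}.
Local Notation mu := (@lebesgue_measure R).
Local Notation mu2 := (@area R).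
Local Notation T := (measurableTypeR R).
Implicit Types (f g k phi h : R * R -> R).

Lemma measure_preserving_shift1 (t : R) :
  measure_preserving mu2 (fun p : R * R => (p.1 + t, p.2)).
Proof.
have ms : measurable_fun setT (fun p : R * R => (p.1 + t, p.2)).
  by apply: measurable_fun_pair => //=; apply: measurable_funD.
split=> // A mA; apply/esym.
apply: (@product_measure_unique _ _ _ _ R mu mu (pushforward mu2 (fun p : T * T => (p.1 + t, p.2) : T * T))) => //.
move=> B C mB mC.
transitivity (mu2 (((fun x => x + t) @^-1` B) `*` C)) => //.
have [ms1 mps] := measure_preserving_shift t.
rewrite /area product_measure1E ?mps// -[X in measurable X]setTI; exact: ms1.
Qed.

Lemma slab_outer phi h (t s0 : R) : 0 < t -> 0 < s0 -> Lloc phi -> Lloc h ->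
  weak_z_dx phi h ->
  (\int[mu2]_p ((s0 <= `|p.2|)%R%:R * (phi (p.1 + t, p.2)%R - phi p) ^+ 2)%:E <=
   (t ^+ 2)%:E * \int[mu2]_p ((s0 <= `|p.2|)%R%:R * (`|p.2| `^ (- 2%:R) * h p ^+ 2))%:E)%E.
Proof.
move=> t0 s00 lphi lh w.
(* After the swap the window runs in [x], so a weight in [z] passes through it; [|z|^-2] undoes the
   factor [z] in front of the increment. *)
pose c (z : R) : R := (s0 <= `|z|)%R%:R * `|z| `^ (- 2%:R).
have mc : measurable_fun setT c.
  by apply: measurable_funM; [exact: measurable_absler|exact: measurable_abs_powR].
have c0 z : 0 <= c z by rewrite mulr_ge0 ?powR_ge0.
have mphi := lphi.1; have mh := lh.1.
have lhs := Lloc_swap lh.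
have mS : measurable_fun setT (fun p : T * T => phi (p.1 + t, p.2) - phi p).
  by apply: measurable_funB => //; apply: (measurableT_comp mphi); exact: (measure_preserving_shift1 t).1.
have mswap := (@measure_preserving_swap R).1.
have mA : measurable_fun setT (fun p : T * T =>
    ((s0 <= `|p.2|)%R%:R * (phi (p.1 + t, p.2) - phi p) ^+ 2)%:E).
  apply/measurable_EFinP/measurable_funM; first by apply: measurable_absler.
  exact: measurable_funX.
have mB : measurable_fun setT (fun p : T * T =>
    ((s0 <= `|p.2|)%R%:R * (`|p.2| `^ (- 2%:R) * h p ^+ 2))%:E).
  apply/measurable_EFinP/measurable_funM; first by apply: measurable_absler.
  by apply: measurable_funM; [apply: measurable_abs_powR|exact: measurable_funX].
rewrite -(ge0_integral_preserving measure_preserving_swap mA); last first.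
  by move=> p; rewrite lee_fin mulr_ge0 ?sqr_ge0.
rewrite -(ge0_integral_preserving measure_preserving_swap mB); last first.
  by move=> p; rewrite lee_fin mulr_ge0// mulr_ge0 ?powR_ge0 ?sqr_ge0.
have mcp : measurable_fun setT (fun p : T * T => c p.1).
  by apply: (measurableT_comp mc); exact: measurable_fst.
have := integral_win_sq_le (ltW t0) lhs.1 mc c0.
have -> : (\int[mu2]_p (c p.1 * win t (fun q => h (q.2, q.1)) p ^+ 2)%:E =
  \int[mu2]_p ((s0 <= `|p.1|)%R%:R * (phi (p.2 + t, p.1)%R - phi (p.2, p.1)) ^+ 2)%:E)%E.
  apply: ae_eq_integral => //.
  - apply/measurable_EFinP/measurable_funM => //.
    by apply: measurable_funX; exact: measurable_win lhs.1.
  - exact: (measurableT_comp mA mswap).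
  - apply: filterS (weak_z_dx_diff t0 lphi lh w) => p /= <- _; congr EFin.
    rewrite /c; have [sp|_] := leP s0 `|p.1|; last by rewrite !mul0r.
    have p0 : p.1 != 0 :> R by rewrite -normr_gt0 (lt_le_trans s00).
    rewrite !mul1r exprMn mulrA powR_invn// real_normK ?num_real//.
    by rewrite mulVf ?mul1r// expf_neq0.
have -> : (\int[mu2]_p (c p.1 * h (p.2, p.1) ^+ 2)%:E = \int[mu2]_p
    ((s0 <= `|p.1|)%R%:R * (`|p.1| `^ (- 2%:R) * h (p.2, p.1) ^+ 2))%:E)%E.
  by apply: eq_integral => p _; rewrite /c mulrA.
by [].
Qed.

Definition xdiff (t : R) phi (p : R * R) : R := phi (p.1 + t, p.2) - phi p.

Definition zdiff2 (s : R) phi (p : R * R) : R :=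
  phi (p.1, p.2 + s + s) - 2 * phi (p.1, p.2 + s) + phi p.

(* Near [z = 0] nothing is known on [d/dx phi]: the second difference in [z]
   moves the increment to the region [s0 <= |z|]. *)
Lemma increment_split phi (t s0 : R) : 0 < s0 -> measurable_fun setT phi ->
  (\int[mu2]_p (xdiff t phi p ^+ 2)%:E <=
   21%:E * \int[mu2]_p ((s0 <= `|p.2|)%R%:R * xdiff t phi p ^+ 2)%:E +
   8%:E * \int[mu2]_p ((`|p.2| < s0)%R%:R * zdiff2 (2 * s0)%R phi p ^+ 2)%:E)%E.
Proof.
move=> s00 mphi; pose S := xdiff t phi; pose D := zdiff2 (2 * s0) phi.
pose s1 := 2 * s0; pose s2 := 2 * s0 + 2 * s0.
have mS : measurable_fun setT (S : T * T -> R).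
  by apply: measurable_funB => //; apply: (measurableT_comp mphi); exact: (measure_preserving_shift1 t).1.
have mD : measurable_fun setT (D : T * T -> R).
  apply: measurable_funD => //; apply: measurable_funB.
    rewrite (_ : (fun p => _) = phi \o (fun p => (p.1, p.2 + s2))); last first.
      by apply/funext => p /=; rewrite addrA.
    by apply: (measurableT_comp mphi); exact: (measure_preserving_shift2 s2).1.
  apply: measurable_funM => //; apply: (measurableT_comp mphi).
  exact: (measure_preserving_shift2 s1).1.
pose A (p : T * T) := ((s0 <= `|p.2|)%R%:R * S p ^+ 2)%:E.
pose B (p : T * T) := ((`|p.2| < s0)%R%:R * D p ^+ 2)%:E.
have A0 p : (0 <= A p)%E by rewrite lee_fin mulr_ge0 ?sqr_ge0.
have B0 p : (0 <= B p)%E by rewrite lee_fin mulr_ge0 ?sqr_ge0.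
have mA : measurable_fun setT A.
  apply/measurable_EFinP/measurable_funM; first by apply: measurable_absler.
  exact: measurable_funX.
have mB : measurable_fun setT B.
  apply/measurable_EFinP/measurable_funM; first by apply: measurable_absltr.
  exact: measurable_funX.
have mA1 : measurable_fun setT (fun p : T * T => A (p.1, (p.2 : R) + s1)).
  by apply: (measurableT_comp mA); exact: (measure_preserving_shift2 s1).1.
have mA2 : measurable_fun setT (fun p : T * T => A (p.1, (p.2 : R) + s2)).
  by apply: (measurableT_comp mA); exact: (measure_preserving_shift2 s2).1.
have mB1 : measurable_fun setT (fun p : T * T => B ((p.1 : R) + t, p.2)).
  by apply: (measurableT_comp mB); exact: (measure_preserving_shift1 t).1.
(* The coefficients come from [(a - b + 2 c - d)^2 <= 4 (a^2 + b^2 + 4 c^2 + d^2)]. Translation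
   invariance then collects them into [1 + 16 + 4] and [4 + 4]. *)
apply: (@le_trans _ _ (\int[mu2]_p ((A p + (16%:E * A (p.1, (p.2 : R) + s1)%R +
    4%:E * A (p.1, (p.2 : R) + s2)%R)) + (4%:E * B ((p.1 : R) + t, p.2)%R + 4%:E * B p))%E)%E).
  apply: ge0_le_integral => //.
  - by move=> p _; rewrite lee_fin sqr_ge0.
  - by apply/measurable_EFinP; exact: measurable_funX.
  - apply: emeasurable_funD; last by apply: emeasurable_funD; exact: measurable_funeM.
    by apply: emeasurable_funD => //; apply: emeasurable_funD; exact: measurable_funeM.
  move=> p _; rewrite /A /B -!EFinM -!EFinD lee_fin /=.
  have [sp|ps] := leP s0 `|p.2|.
    rewrite mul1r -addrA lerDl !mul0r !mulr0 !addr0 addr_ge0//.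
      by rewrite mulr_ge0// mulr_ge0 ?sqr_ge0.
    by rewrite mulr_ge0// mulr_ge0 ?sqr_ge0.
  have [h1 h2] : s0 <= `|p.2 + s1| /\ s0 <= `|p.2 + s2|.
    move: ps; rewrite ltr_norml /s1 /s2 => /andP[? ?].
    by split; apply: (le_trans _ (ler_norm _)); lra.
  rewrite h1 h2 !mul1r mul0r add0r.
  (* The second difference in [z] commutes with the increment in [x]; solving for the increment at
     [z] leaves those at [z + 2 s0] and [z + 4 s0], both in the outer region. *)
  have -> : xdiff t phi p = (D (p.1 + t, p.2) - D p) + (2 * S (p.1, p.2 + s1) - S (p.1, p.2 + s2)).
    by rewrite /S /D /xdiff /zdiff2 /s1 /s2 /= !addrA; ring.
  set a := D _; set b := D _; set c := S _; set d := S _.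
  have := sqr_ge0 (a + b); have := sqr_ge0 (a - (2 * c)); have := sqr_ge0 (a + d).
  have := sqr_ge0 (b + 2 * c); have := sqr_ge0 (b - d); have := sqr_ge0 (2 * c + d).
  rewrite !expr2; lra.
have p2 (F : T * T -> \bar R) (r : R) : measurable_fun setT F ->
    (forall p, 0 <= F p)%E -> 0 <= r ->
    (\int[mu2]_p (r%:E * F p) = r%:E * \int[mu2]_p F p)%E.
  by move=> mf f0 r0; rewrite ge0_integralZl.
have n0 (r : R) (x : \bar R) : 0 <= r -> (0 <= x)%E -> (0 <= r%:E * x)%E.
  by move=> r0 x0; rewrite mule_ge0 ?lee_fin.
rewrite ge0_integralD//; first last.
- by apply: emeasurable_funD; exact: measurable_funeM.
- by move=> p _; rewrite adde_ge0// n0.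
- by apply: emeasurable_funD => //; apply: emeasurable_funD; exact: measurable_funeM.
- by move=> p _; rewrite !adde_ge0// n0.
rewrite ge0_integralD//; first last.
- by apply: emeasurable_funD; exact: measurable_funeM.
- by move=> p _; rewrite !adde_ge0// n0.
rewrite ge0_integralD//; first last.
- exact: measurable_funeM.
- by move=> p _; rewrite n0.
- exact: measurable_funeM.
- by move=> p _; rewrite n0.
rewrite ge0_integralD//; first last.
- exact: measurable_funeM.
- by move=> p _; rewrite n0.
- exact: measurable_funeM.
- by move=> p _; rewrite n0.
rewrite !p2//.
rewrite (ge0_integral_preserving (measure_preserving_shift2 s1) mA A0).
rewrite (ge0_integral_preserving (measure_preserving_shift2 s2) mA A0).
rewrite (ge0_integral_preserving (measure_preserving_shift1 t) mB B0).
set IA := (\int[_]_p A p)%E; set IB := (\int[_]_p B p)%E.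
have IA0 : (0 <= IA)%E by exact: integral_ge0.
have IB0 : (0 <= IB)%E by exact: integral_ge0.
have -> : (21%:E = 1%:E + (16%:E + 4%:E) :> \bar R)%E.
  by rewrite -!EFinD; congr EFin; ring.
have -> : (8%:E = 4%:E + 4%:E :> \bar R)%E by rewrite -!EFinD; congr EFin; ring.
by rewrite !ge0_muleDl ?mul1e ?adde_ge0 ?lee_fin.
Qed.

End increments.

(** * Integration over the scale [t] *)

Section scale_integrals.
Context {R : realType}.
Local Notation mu := (@lebesgue_measure R).
Local Notation mu2 := (@area R).
Local Notation T := (measurableTypeR R).
Implicit Types (phi gz gzz h : R * R -> R).

Lemma powR_cube (t : R) : 0 <= t -> (t `^ 3^-1) ^+ 3 = t.
Proof. by move=> t0; rewrite -powR_mulrn ?powR_ge0// -powRrM mulVf// powRr1. Qed.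

Lemma powRX (a q : R) (n : nat) : 0 <= a -> (a ^+ n) `^ q = a `^ (n%:R * q).
Proof. by move=> a0; rewrite -powR_mulrn// -powRrM. Qed.

Lemma powR_addr (t a b : R) : 0 < t -> t `^ a * t `^ b = t `^ (a + b).
Proof. by move=> t0; rewrite -powRD//; apply/implyP => _; rewrite gt_eqF. Qed.

(** The slab conditions read at fixed [z] as conditions on [t]: here [t <= |z|^3], and
    [t > (|z| / 5)^3] for [inner_scales]. The two ranges overlap, since the slab is widened by 5. *)
Definition outer_scales (z t : R) : R := ((0 < t) && (t `^ 3^-1 <= `|z|))%R%:R.

Definition inner_scales (z t : R) : R := ((0 < t) && (`|z| < 5 * t `^ 3^-1))%R%:R.

Lemma integral_outer_scales (z : R) :
  (\int[mu]_t (outer_scales z t * t `^ (- 3^-1))%:E <= (3 / 2 * `|z| ^+ 2)%:E)%E.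
Proof.
have q0 : 0 < 2 / 3 :> R by lra.
have -> : - 3^-1 = 2 / 3 - 1 :> R by lra.
have z3 : 0 <= `|z| ^+ 3 by rewrite exprn_ge0.
have := integral_powR_near0 q0 z3; rewrite powRX//.
have -> : 3%:R * (2 / 3) = 2%:R :> R by lra.
rewrite powR_mulrn// => H; apply: (@le_trans _ _ (`|z| ^+ 2 / (2 / 3))%:E); last first.
  by rewrite lee_fin invf_div mulrC.
apply: le_trans H; rewrite [leRHS]integral_mkcond; apply: ge0_le_integral => //.
- by move=> t _; rewrite lee_fin mulr_ge0 ?powR_ge0.
- apply/measurable_EFinP/measurable_funM; last exact: measurable_powR.
  apply: measurable_fun_natbool; apply: measurable_and; first exact: measurable_fun_ltr.
  by apply: measurable_fun_ler => //; exact: measurable_powR.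
- by apply/(measurable_restrictT _ _).1 => //; exact: measurable_powR_EFin.
move=> t _; rewrite patchE mem_setE in_itv/= /outer_scales.
have [t0|_] := ltP 0 t; last by rewrite mul0r.
have [tz|_] := leP (t `^ 3^-1) `|z|; last by rewrite mul0r; case: ifP => _; rewrite // lee_fin powR_ge0.
have tz3 : t <= `|z| ^+ 3.
  by rewrite -(powR_cube (ltW t0)) lerXn2r ?nnegrE ?powR_ge0.
by rewrite mul1r tz3.
Qed.

(** As [- 7/6 = - 1/6 - 1], the integral converges at infinity and a primitive evaluated at
    [(|z| / 5)^3] yields the power [-1/2], inverse to the weight [|z|^(1/2)]. *)
Lemma integral_inner_scales (z : R) : z != 0 ->
  (\int[mu]_t (inner_scales z t * t `^ (- (7 / 6)))%:E <= (6 * (`|z| / 5) `^ (- 2^-1))%:E)%E.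
Proof.
move=> z0; have q0 : 0 < 6^-1 :> R by lra.
have -> : - (7 / 6) = - 6^-1 - 1 :> R by lra.
have z5 : 0 < `|z| / 5 by rewrite divr_gt0 ?normr_gt0.
have z3 : 0 < (`|z| / 5) ^+ 3 by rewrite exprn_gt0.
have e : ((`|z| / 5) ^+ 3) `^ (- 6^-1) = (`|z| / 5) `^ (- 2^-1).
  by rewrite powRX ?ltW//; congr (_ `^ _); lra.
have := integral_powR_tail q0 z3; rewrite e.
rewrite invrK (mulrC _ 6) => H; apply: le_trans H.
rewrite [leRHS]integral_mkcond; apply: ge0_le_integral => //.
- by move=> t _; rewrite lee_fin mulr_ge0 ?powR_ge0.
- apply/measurable_EFinP/measurable_funM; last exact: measurable_powR.
  apply: measurable_fun_natbool; apply: measurable_and; first exact: measurable_fun_ltr.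
  by apply: measurable_fun_ltr => //; apply: measurable_funM => //; exact: measurable_powR.
- by apply/(measurable_restrictT _ _).1 => //; exact: measurable_powR_EFin.
move=> t _; rewrite patchE mem_setE in_itv/= andbT /inner_scales.
have [t0|_] := ltP 0 t; last by rewrite mul0r; case: ifP => _; rewrite // lee_fin powR_ge0.
have [tz|_] := ltP `|z| (5 * t `^ 3^-1); last by rewrite mul0r; case: ifP => _; rewrite // lee_fin powR_ge0.
have zt : `|z| / 5 <= t `^ 3^-1 by rewrite ler_pdivrMr// mulrC ltW.
have tz3 : (`|z| / 5) ^+ 3 <= t.
  by rewrite -(powR_cube (ltW t0)) lerXn2r ?nnegrE ?powR_ge0// ltW.
by rewrite mul1r tz3.
Qed.

(** Joint densities in [t] and [p]: integrated over the plane they control the increment of step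
    [t], integrated in [t] they reduce to multiples of [h^2] and [gzz^2]. *)
Definition outer_density h (t : R) (p : R * R) : R :=
  outer_scales p.2 t * t `^ (- 3^-1) * (`|p.2| `^ (- 2%:R) * h p ^+ 2).

Definition inner_density gzz (t : R) (p : R * R) : R :=
  inner_scales p.2 t * t `^ (- (7 / 6)) * (`|p.2| `^ 2^-1 * gzz p ^+ 2).

Lemma outer_density_ge0 h t p : 0 <= outer_density h t p.
Proof. by rewrite mulr_ge0// mulr_ge0 ?powR_ge0 ?sqr_ge0. Qed.

Lemma inner_density_ge0 h t p : 0 <= inner_density h t p.
Proof. by rewrite mulr_ge0// mulr_ge0 ?powR_ge0 ?sqr_ge0. Qed.

Lemma increment_bound phi gz gzz h (t : R) : inZ0 phi gz gzz h -> 0 < t ->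
  ((t `^ (- (7 / 3)))%:E * \int[mu2]_p (xdiff t phi p ^+ 2)%:E <=
   21%:E * \int[mu2]_p (outer_density h t p)%:E +
   (16 ^+ 2 * 5 `^ 2^-1)%:E * \int[mu2]_p (inner_density gzz t p)%:E)%E.
Proof.
move=> [L2phi [L2gz [L2gzz [L2h [w1 [w2 w3]]]]]] t0.
have lphi := L2_Lloc L2phi; have lgz := L2_Lloc L2gz.
have lk := L2_Lloc L2gzz; have lh := L2_Lloc L2h.
have mphi := lphi.1; have mk := lk.1; have mh := lh.1.
pose s0 := t `^ 3^-1.
have s00 : 0 < s0 by rewrite powR_gt0.
have s20 : 0 < 2 * s0 by rewrite mulr_gt0.
have tw0 : (0 <= (t `^ (- (7 / 3)))%:E)%E by rewrite lee_fin powR_ge0.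
have split := increment_split t s00 mphi.
have outer := slab_outer t0 s00 lphi lh w3.
have inner := integral_win2_le s00 mk.
have mw2 : measurable_fun setT (win (2 * s0) (win (2 * s0) gzz)).
  by apply: measurable_win; exact: measurable_win.
have mz2 : measurable_fun setT (zdiff2 (2 * s0) phi).
  have ms := (measure_preserving_shift2 (2 * s0)).1.
  apply: measurable_funD => //; apply: measurable_funB.
    by apply: (measurableT_comp mphi); exact: (measurableT_comp ms ms).
  by apply: measurable_funM => //; exact: (measurableT_comp mphi ms).
have innerE : (\int[mu2]_p ((`|p.2| < s0)%R%:R * zdiff2 (2 * s0)%R phi p ^+ 2)%:E =
    \int[mu2]_p ((`|p.2| < s0)%R%:R * win (2 * s0) (win (2 * s0) gzz) p ^+ 2)%:E)%E.
  apply: ae_eq_integral => //.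
  - apply/measurable_EFinP/measurable_funM; first by apply: measurable_absltr.
    exact: measurable_funX.
  - apply/measurable_EFinP/measurable_funM; first by apply: measurable_absltr.
    exact: measurable_funX.
  - apply: filterS (weak_dz_diff2 s20 lphi lgz lk w1 w2) => p H _.
    by rewrite /zdiff2 H.
rewrite innerE in split.
pose I1 := (\int[mu2]_p ((s0 <= `|p.2|)%R%:R * (`|p.2| `^ (- 2%:R) * h p ^+ 2))%:E)%E.
pose I2 := (\int[mu2]_p ((`|p.2| < 5 * s0)%R%:R * (`|p.2| `^ 2^-1 * gzz p ^+ 2))%:E)%E.
have I10 : (0 <= I1)%E.
  by apply: integral_ge0 => p _; rewrite lee_fin mulr_ge0// mulr_ge0 ?powR_ge0 ?sqr_ge0.
have I20 : (0 <= I2)%E.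
  by apply: integral_ge0 => p _; rewrite lee_fin mulr_ge0// mulr_ge0 ?powR_ge0 ?sqr_ge0.
have E1 : (\int[mu2]_p (outer_density h t p)%:E = (t `^ (- 3^-1))%:E * I1)%E.
  rewrite -ge0_integralZl//; first last.
  - by rewrite lee_fin powR_ge0.
  - by move=> p _; rewrite lee_fin mulr_ge0// mulr_ge0 ?powR_ge0 ?sqr_ge0.
  - apply/measurable_EFinP/measurable_funM; first by apply: measurable_absler.
    by apply: measurable_funM; [apply: measurable_abs_powR|exact: measurable_funX].
  apply: eq_integral => p _; rewrite -EFinM; congr EFin.
  by rewrite /outer_density /outer_scales t0/= -/s0 (mulrC _ (t `^ _)) -mulrA.
have E2 : (\int[mu2]_p (inner_density gzz t p)%:E = (t `^ (- (7 / 6)))%:E * I2)%E.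
  rewrite -ge0_integralZl//; first last.
  - by rewrite lee_fin powR_ge0.
  - by move=> p _; rewrite lee_fin mulr_ge0// mulr_ge0 ?powR_ge0 ?sqr_ge0.
  - apply/measurable_EFinP/measurable_funM; first by apply: measurable_absltr.
    by apply: measurable_funM; [apply: measurable_abs_powR|exact: measurable_funX].
  apply: eq_integral => p _; rewrite -EFinM; congr EFin.
  by rewrite /inner_density /inner_scales t0/= -/s0 (mulrC _ (t `^ _)) -mulrA.
rewrite E1 E2.
have J : (\int[mu2]_p (xdiff t phi p ^+ 2)%:E <=
    21%:E * ((t ^+ 2)%:E * I1) + 8%:E * ((32 * s0 ^+ 3 * (5 * s0) `^ 2^-1)%:E * I2))%E.
  by apply: (le_trans split); apply: leeD; apply: lee_wpmul2l; rewrite ?lee_fin.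
apply: (le_trans (lee_wpmul2l tw0 J)).
(* Exponents: [- 7/3 + 2 = - 1/3] outside; inside, [s0^3 * s0^(1/2)] is [t^(1 + 1/6)] and
   [- 7/3 + 7/6 = - 7/6]. The constant is [8 * 32 = 16^2]. *)
have p1 : t `^ (- (7 / 3)) * t ^+ 2 = t `^ (- 3^-1).
  rewrite -powR_mulrn ?(ltW t0)// powR_addr//; congr (_ `^ _); lra.
have p2 : t `^ (- (7 / 3)) * (t * s0 `^ 2^-1) = t `^ (- (7 / 6)).
  rewrite /s0 -powRrM -{2}(powRr1 (ltW t0)) !powR_addr//; congr (_ `^ _); lra.
rewrite ge0_muleDr ?mule_ge0 ?lee_fin ?sqr_ge0//; last first.
  by rewrite mulr_ge0 ?powR_ge0// mulr_ge0// exprn_ge0 ?ltW.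
rewrite !muleA -!EFinM le_eqVlt; apply/orP; left; apply/eqP.
congr (_%:E * _ + _%:E * _)%E; first by rewrite -p1; ring.
rewrite -p2 /s0 powR_cube ?(ltW t0)// -/s0 powRM ?ltW//; ring.
Qed.

End scale_integrals.

(** * Assembling the Slobodeckij seminorm *)

Section embedding.
Context {R : realType}.
Local Notation mu := (@lebesgue_measure R).
Local Notation mu2 := (@area R).
Local Notation T := (measurableTypeR R).
Implicit Types (phi gz gzz h : R * R -> R).

Lemma measurable_densities h : measurable_fun setT h ->
  measurable_fun setT (fun q : (T * T) * T => (outer_density h q.2 q.1)%:E) /\
  measurable_fun setT (fun q : (T * T) * T => (inner_density h q.2 q.1)%:E).
Proof.
move=> mh.
have m12 : measurable_fun setT (fun q : (T * T) * T => (q.1.2 : R)).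
  exact: (measurableT_comp measurable_snd measurable_fst).
have m2 : measurable_fun setT (fun q : (T * T) * T => (q.2 : R)) by exact: measurable_snd.
have mhq : measurable_fun setT (fun q : (T * T) * T => h q.1 ^+ 2).
  by apply: measurable_funX; apply: (measurableT_comp mh); exact: measurable_fst.
have mabs : measurable_fun setT (fun q : (T * T) * T => `|q.1.2 : R|).
  exact: measurableT_comp.
have mp (r : R) : measurable_fun setT (fun q : (T * T) * T => (q.2 : R) `^ r).
  by apply: (measurableT_comp (measurable_powR r)).
split; apply/measurable_EFinP/measurable_funM.
- apply: measurable_funM => //; apply: measurable_fun_natbool; apply: measurable_and.
    exact: measurable_fun_ltr.
  exact: measurable_fun_ler.
- by apply: measurable_funM => //; exact: measurable_abs_powR.
- apply: measurable_funM => //; apply: measurable_fun_natbool; apply: measurable_and.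
    exact: measurable_fun_ltr.
  by apply: measurable_fun_ltr => //; exact: measurable_funM.
- by apply: measurable_funM => //; exact: measurable_abs_powR.
Qed.

Lemma integral_outer_density h (p : R * R) :
  (\int[mu]_t (outer_density h t p)%:E <= (3 / 2 * h p ^+ 2)%:E)%E.
Proof.
pose c : R := `|p.2| `^ (- 2%:R) * h p ^+ 2.
have c0 : 0 <= c by rewrite mulr_ge0 ?powR_ge0 ?sqr_ge0.
have -> : (\int[mu]_t (outer_density h t p)%:E =
    c%:E * \int[mu]_t (outer_scales p.2 t * t `^ (- 3^-1))%:E)%E.
  rewrite -ge0_integralZl//; first last.
  - by move=> t _; rewrite lee_fin mulr_ge0 ?powR_ge0.
  - apply/measurable_EFinP/measurable_funM; last exact: measurable_powR.
    apply: measurable_fun_natbool; apply: measurable_and; first exact: measurable_fun_ltr.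
    by apply: measurable_fun_ler => //; exact: measurable_powR.
  by apply: eq_integral => t _; rewrite -EFinM mulrC.
have c0' : (0 <= c%:E)%E by rewrite lee_fin.
apply: (le_trans (lee_wpmul2l c0' (integral_outer_scales p.2))).
rewrite -EFinM lee_fin /c.
have [->|z0] := eqVneq p.2 0.
  by rewrite normr0 expr0n/= !mulr0 mulr_ge0 ?sqr_ge0.
have n0 : `|p.2| ^+ 2 != 0 by rewrite expf_neq0// normr_eq0.
rewrite powR_invn// le_eqVlt; apply/orP; left; apply/eqP.
by rewrite (mulrC (3 / 2) (`|p.2| ^+ 2)) mulrACA mulVf// mul1r mulrC.
Qed.

Lemma integral_inner_density h (p : R * R) :
  (\int[mu]_t (inner_density h t p)%:E <= (6 * 5 `^ 2^-1 * h p ^+ 2)%:E)%E.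
Proof.
pose c : R := `|p.2| `^ 2^-1 * h p ^+ 2.
have c0 : 0 <= c by rewrite mulr_ge0 ?powR_ge0 ?sqr_ge0.
have -> : (\int[mu]_t (inner_density h t p)%:E =
    c%:E * \int[mu]_t (inner_scales p.2 t * t `^ (- (7 / 6)))%:E)%E.
  rewrite -ge0_integralZl//; first last.
  - by move=> t _; rewrite lee_fin mulr_ge0 ?powR_ge0.
  - apply/measurable_EFinP/measurable_funM; last exact: measurable_powR.
    apply: measurable_fun_natbool; apply: measurable_and; first exact: measurable_fun_ltr.
    by apply: measurable_fun_ltr => //; apply: measurable_funM => //; exact: measurable_powR.
  by apply: eq_integral => t _; rewrite -EFinM mulrC.
have c0' : (0 <= c%:E)%E by rewrite lee_fin.
(* On [z = 0] every [t > 0] is an inner scale and the [t]-integral is infinite; the weight [c] is 0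
   there and [0 * +oo = 0]. *)
have [z0|z0] := eqVneq p.2 0.
  rewrite /c z0 normr0 powR0 ?mul0r ?mul0e ?lee_fin//.
  by rewrite mulr_ge0 ?sqr_ge0// mulr_ge0 ?powR_ge0.
apply: (le_trans (lee_wpmul2l c0' (integral_inner_scales z0))).
rewrite -EFinM lee_fin /c.
have z5 : 0 < `|p.2| / 5 by rewrite divr_gt0 ?normr_gt0.
have e : (`|p.2| / 5) `^ 2^-1 * (`|p.2| / 5) `^ (- 2^-1) = 1.
  by rewrite powR_addr// addrN powRr0.
have e2 : `|p.2| `^ 2^-1 = (`|p.2| / 5) `^ 2^-1 * 5 `^ 2^-1.
  by rewrite -powRM ?(ltW z5)// divfK.
rewrite le_eqVlt; apply/orP; left; apply/eqP.
transitivity ((`|p.2| / 5) `^ 2^-1 * (`|p.2| / 5) `^ (- 2^-1) *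
  (6 * 5 `^ 2^-1 * h p ^+ 2)); last by rewrite e mul1r.
by rewrite {1}e2; ring.
Qed.

(** The Slobodeckij integrand in the variables [((x, z), t)] with [y = x + t], on the half
    [y > x]. *)
Definition gagliardo phi (q : (R * R) * R) : R :=
  (0 < q.2)%R%:R * (q.2 `^ (- (7 / 3)) * xdiff q.2 phi q.1 ^+ 2).

Lemma gagliardo_ge0 phi q : 0 <= gagliardo phi q.
Proof. by rewrite mulr_ge0// mulr_ge0 ?powR_ge0 ?sqr_ge0. Qed.

Lemma measurable_gagliardo phi : measurable_fun setT phi ->
  measurable_fun setT (fun q : (T * T) * T => (gagliardo phi q)%:E).
Proof.
move=> mphi; apply/measurable_EFinP/measurable_funM.
  by apply: measurable_fun_natbool; apply: measurable_fun_ltr => //; exact: measurable_snd.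
apply: measurable_funM.
  by apply: (measurableT_comp (measurable_powR _)); exact: measurable_snd.
apply: measurable_funX; apply: measurable_funB; last first.
  by apply: (measurableT_comp mphi); exact: measurable_fst.
apply: measurable_line => //.
  apply: measurable_funD; last exact: measurable_snd.
  exact: (measurableT_comp measurable_fst measurable_fst).
exact: (measurableT_comp measurable_snd measurable_fst).
Qed.

(** The inner coefficient of [increment_bound] times the constant of [integral_inner_density]. *)
Definition Cin : R := 16 ^+ 2 * 5 `^ 2^-1 * (6 * 5 `^ 2^-1).

Lemma Cin_ge0 : 0 <= Cin.
Proof. by rewrite /Cin mulr_ge0. Qed.

(** Tonelli is used in both directions: [t] is moved outside because [increment_bound] is a plane
    integral at fixed [t], then back inside because the densities are integrated in [t] at a fixed
    point. *)
Lemma integral_gagliardo_le phi gz gzz h : inZ0 phi gz gzz h ->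
  (\int[mu2]_p \int[mu]_t (gagliardo phi (p, t))%:E <=
   32%:E * \int[mu2]_p (h p ^+ 2)%:E + Cin%:E * \int[mu2]_p (gzz p ^+ 2)%:E)%E.
Proof.
move=> Z; have [[mphi _] [_ [[mk _] [[mh _] _]]]] := Z.
have mG := measurable_gagliardo mphi.
have G0 (q : (T * T) * T) : (0 <= (gagliardo phi q)%:E)%E by rewrite lee_fin gagliardo_ge0.
have [mO _] := measurable_densities mh.
have [_ mI] := measurable_densities mk.
have O0 (q : (T * T) * T) : (0 <= (outer_density h q.2 q.1)%:E)%E.
  by rewrite lee_fin outer_density_ge0.
have I0 (q : (T * T) * T) : (0 <= (inner_density gzz q.2 q.1)%:E)%E.
  by rewrite lee_fin inner_density_ge0.
have fG := @fubini_tonelli _ _ _ _ R mu2 mu _ mG G0.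
have fO := @fubini_tonelli _ _ _ _ R mu2 mu _ mO O0.
have fI := @fubini_tonelli _ _ _ _ R mu2 mu _ mI I0.
have mOt := measurable_fun_fubini_tonelli_G (m1 := mu2) _ mO O0.
have mIt := measurable_fun_fubini_tonelli_G (m1 := mu2) _ mI I0.
have mGt := measurable_fun_fubini_tonelli_G (m1 := mu2) _ mG G0.
have mOp := measurable_fun_fubini_tonelli_F (m2 := mu) _ mO O0.
have mIp := measurable_fun_fubini_tonelli_F (m2 := mu) _ mI I0.
have c0 : 0 <= 16 ^+ 2 * 5 `^ 2^-1 :> R by rewrite mulr_ge0 ?powR_ge0// sqr_ge0.
have Ot0 t : (0 <= \int[mu2]_p (outer_density h t p)%:E)%E.
  by apply: integral_ge0 => p _; rewrite lee_fin outer_density_ge0.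
have It0 t : (0 <= \int[mu2]_p (inner_density gzz t p)%:E)%E.
  by apply: integral_ge0 => p _; rewrite lee_fin inner_density_ge0.
have Op0 p : (0 <= \int[mu]_t (outer_density h t p)%:E)%E.
  by apply: integral_ge0 => t _; rewrite lee_fin outer_density_ge0.
have Ip0 p : (0 <= \int[mu]_t (inner_density gzz t p)%:E)%E.
  by apply: integral_ge0 => t _; rewrite lee_fin inner_density_ge0.
apply: (@le_trans _ _ (\int[mu]_t (21%:E * \int[mu2]_p (outer_density h t p)%:E +
    (16 ^+ 2 * 5 `^ 2^-1)%:E * \int[mu2]_p (inner_density gzz t p)%:E))%E).
  rewrite (etrans (erefl _) fG); apply: ge0_le_integral => //.
  - by move=> t _; apply: integral_ge0 => p _; rewrite lee_fin gagliardo_ge0.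
  - by apply: emeasurable_funD; apply: measurable_funeM.
  move=> t _; have [t0|t0] := leP t 0.
    rewrite integral0_eq ?adde_ge0 ?mule_ge0 ?lee_fin// => p _.
    by rewrite /gagliardo/= ltNge t0/= mul0r.
  apply: le_trans (increment_bound Z t0).
  rewrite -ge0_integralZl//; first last.
  - by rewrite lee_fin powR_ge0.
  - by move=> p _; rewrite lee_fin sqr_ge0.
  - apply/measurable_EFinP; apply: measurable_funX; apply: measurable_funB => //.
    by apply: (measurableT_comp mphi); exact: (measure_preserving_shift1 t).1.
  rewrite le_eqVlt; apply/orP; left; apply/eqP.
  by apply: eq_integral => p _; rewrite /gagliardo/= t0 mul1r EFinM.
rewrite ge0_integralD; [|exact: measurableT| | | |]; first last.
- by apply: measurable_funeM; exact: mIt.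
- by move=> t _; rewrite mule_ge0 ?lee_fin.
- by apply: measurable_funeM; exact: mOt.
- by move=> t _; rewrite mule_ge0 ?lee_fin.
have zO := @ge0_integralZl _ _ _ mu _ measurableT _ mOt 21%:E (fun t _ => Ot0 t).
have zI := @ge0_integralZl _ _ _ mu _ measurableT _ mIt (16 ^+ 2 * 5 `^ 2^-1)%:E
  (fun t _ => It0 t).
rewrite (etrans (erefl _) (zO _)) ?lee_fin// (etrans (erefl _) (zI _)) ?lee_fin//.
rewrite /fubini_G -[X in (21%:E * X + _)%E]fO -[X in (_ + _ * X)%E]fI.
have mh2 : measurable_fun setT (fun p : T * T => (h p ^+ 2)%:E).
  by apply/measurable_EFinP; exact: measurable_funX.
have mk2 : measurable_fun setT (fun p : T * T => (gzz p ^+ 2)%:E).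
  by apply/measurable_EFinP; exact: measurable_funX.
have s0 (f : R * R -> R) p : (0 <= (f p ^+ 2)%:E)%E by rewrite lee_fin sqr_ge0.
have ZI (r : R) (f : R * R -> R) : 0 <= r -> measurable_fun setT (fun p : T * T => (f p ^+ 2)%:E) ->
    (\int[mu2]_p (r * f p ^+ 2)%:E = r%:E * \int[mu2]_p (f p ^+ 2)%:E)%E.
  move=> r0 mf; rewrite -ge0_integralZl//.
apply: leeD.
  apply: (@le_trans _ _ (21%:E * ((3 / 2)%:E * \int[mu2]_p (h p ^+ 2)%:E))%E).
    apply: lee_wpmul2l; first by rewrite lee_fin.
    rewrite -ZI//.
    apply: ge0_le_integral; [exact: measurableT|by move=> p _; exact: Op0|exact mOp| |].
    - by apply/measurable_EFinP; apply: measurable_funM => //; exact: measurable_funX.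
    - by move=> p _; exact: integral_outer_density.
  (* The constant [21 * 3/2 = 63/2] is rounded up to 32. *)
  rewrite muleA -EFinM; apply: lee_wpmul2r; last by rewrite lee_fin; lra.
  by apply: integral_ge0 => p _; exact: s0.
apply: (@le_trans _ _ ((16 ^+ 2 * 5 `^ 2^-1)%:E * ((6 * 5 `^ 2^-1)%:E * \int[mu2]_p (gzz p ^+ 2)%:E))%E).
  apply: lee_wpmul2l; first by rewrite lee_fin.
  rewrite -ZI//.
  apply: ge0_le_integral; [exact: measurableT|by move=> p _; exact: Ip0|exact mIp| |].
  - by apply/measurable_EFinP; apply: measurable_funM => //; exact: measurable_funX.
  - by move=> p _; exact: integral_inner_density.
by rewrite muleA -EFinM.
Qed.

Definition slobodeckij_kernel phi (z x y : R) : R :=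
  `|phi (x, z) - phi (y, z)| ^+ 2 / (`|x - y| `^ (7 / 3)).

Lemma slobodeckij_kernel_ge0 phi z x y : 0 <= slobodeckij_kernel phi z x y.
Proof. by rewrite divr_ge0 ?powR_ge0 ?exprn_ge0. Qed.

Lemma measurable_slobodeckij_kernel phi z : measurable_fun setT phi ->
  measurable_fun setT (fun p : T * T => slobodeckij_kernel phi z p.1 p.2).
Proof.
move=> mphi.
have -> : (fun p : T * T => slobodeckij_kernel phi z p.1 p.2) =
    (fun p : T * T => `|phi (p.1, z) - phi (p.2, z)| ^+ 2 * `|(p.1 : R) - p.2| `^ (- (7 / 3))).
  by apply/funext => p; rewrite /slobodeckij_kernel powRN.
apply: measurable_funM.
  apply: measurable_funX; apply: measurableT_comp => //.
  by apply: measurable_funB; apply: measurable_line.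
by apply: measurable_abs_powR; apply: measurable_funB.
Qed.

(** The kernel is symmetric in [x] and [y] and vanishes on the diagonal with its numerator, so the
    full integral is twice the half [x < y], where [t = y - x]. *)
Lemma slobodeckij_le_gagliardo phi (z : R) : measurable_fun setT phi ->
  (\int[mu]_x \int[mu]_y (slobodeckij_kernel phi z x y)%:E <=
   2%:E * \int[mu]_x \int[mu]_t (gagliardo phi ((x, z), t))%:E)%E.
Proof.
move=> mphi.
pose K (p : T * T) := (slobodeckij_kernel phi z p.1 p.2)%:E.
pose K1 (p : T * T) := (((p.1 : R) < p.2)%R%:R * slobodeckij_kernel phi z p.1 p.2)%:E.
pose K2 (p : T * T) := K1 (p.2, p.1).
have mK := measurable_slobodeckij_kernel z mphi.
have mK1 : measurable_fun setT K1.
  apply/measurable_EFinP/measurable_funM => //.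
  by apply: measurable_fun_natbool; exact: measurable_fun_ltr.
have mK2 : measurable_fun setT K2 by apply: (measurableT_comp mK1); exact: measurable_fun_pair.
have K10 p : (0 <= K1 p)%E by rewrite lee_fin mulr_ge0 ?slobodeckij_kernel_ge0.
have K20 p : (0 <= K2 p)%E by exact: K10.
have F1 := measurable_fun_fubini_tonelli_F (m2 := mu) _ mK1 K10.
have F2 := measurable_fun_fubini_tonelli_F (m2 := mu) _ mK2 K20.
have KE (x y : R) : K (x, y) = (K1 (x, y) + K2 (x, y))%E.
  rewrite /K /K1 /K2 /= -EFinD; congr EFin.
  have sym : slobodeckij_kernel phi z y x = slobodeckij_kernel phi z x y.
    by rewrite /slobodeckij_kernel distrC (distrC y).
  rewrite sym; case: (ltrgtP x y) => [_|_|->]; rewrite ?mul1r ?mul0r ?addr0 ?add0r//.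
  by rewrite /slobodeckij_kernel !subrr normr0 expr0n/= mul0r.
have -> : (\int[mu]_x \int[mu]_y (slobodeckij_kernel phi z x y)%:E =
    \int[mu]_x \int[mu]_y K1 (x, y) + \int[mu]_x \int[mu]_y K2 (x, y))%E.
  transitivity (\int[mu]_x (fubini_F mu K1 x + fubini_F mu K2 x))%E; last first.
    rewrite ge0_integralD; [by []|exact: measurableT| |exact: F1| |exact: F2].
    - by move=> x _; apply: integral_ge0 => y _; exact: K10.
    - by move=> x _; apply: integral_ge0 => y _; exact: K20.
  apply: eq_integral => x _; transitivity (\int[mu]_y (K1 (x, y) + K2 (x, y)))%E.
    by apply: eq_integral => y _; exact: KE.
  rewrite ge0_integralD; [by []|exact: measurableT| | | |].
  - by move=> y _; exact: K10.
  - by apply: (measurableT_comp mK1); exact: measurable_fun_pair.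
  - by move=> y _; exact: K20.
  - by apply: (measurableT_comp mK2); exact: measurable_fun_pair.
have f2 := @fubini_tonelli _ _ _ _ R mu mu _ mK2 K20.
rewrite [X in (_ + X)%E]f2.
have E : (\int[mu]_x \int[mu]_y K1 (x, y) =
    \int[mu]_x \int[mu]_t (gagliardo phi ((x, z), t))%:E)%E.
  apply: eq_integral => x _.
  have mK1x : measurable_fun setT (fun y : T => K1 (x, y)).
    by apply: (measurableT_comp mK1); exact: measurable_fun_pair.
  have H := ge0_integral_preserving (measure_preserving_shift x) mK1x (fun y => K10 (x, y)).
  apply: (etrans (esym H)).
  apply: eq_integral => t _; rewrite /K1 /gagliardo /xdiff /slobodeckij_kernel /=.
  rewrite ltrDr (addrC t x); have [t0|_] := ltP 0 t; last by rewrite !mul0r.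
  have e1 : `|phi (x, z) - phi (x + t, z)| ^+ 2 = (phi (x + t, z) - phi (x, z)) ^+ 2.
    by rewrite distrC real_normK ?num_real.
  have e2 : `|x - (x + t)| = t by rewrite opprD addrA subrr sub0r normrN gtr0_norm.
  by rewrite e1 e2 powRN mul1r [in RHS]mul1r mulrC.
by rewrite E mule_natl mule2n.
Qed.

Lemma slobodeckij_le phi gz gzz h : inZ0 phi gz gzz h ->
  (\int[mu]_z \int[mu]_x \int[mu]_y (slobodeckij_kernel phi z x y)%:E <=
   (2 * 32)%:E * \int[mu2]_p (h p ^+ 2)%:E + (2 * Cin)%:E * \int[mu2]_p (gzz p ^+ 2)%:E)%E.
Proof.
move=> Z; have [[mphi _] _] := Z.
have mG := measurable_gagliardo mphi.
have G0 (q : (T * T) * T) : (0 <= (gagliardo phi q)%:E)%E by rewrite lee_fin gagliardo_ge0.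
have mF := measurable_fun_fubini_tonelli_F (m2 := mu) _ mG G0.
have F0 (p : T * T) : (0 <= fubini_F mu (fun q : (T * T) * T => (gagliardo phi q)%:E) p)%E.
  by apply: integral_ge0 => t _; exact: G0.
have mH := measurable_fun_fubini_tonelli_G (m1 := mu) _ mF F0.
(* The norm integrates in [z] outermost; this is Tonelli in the reversed order, back to the plane
   integral. *)
have f := @fubini_tonelli2 _ _ _ _ R mu mu _ mF F0.
have mK3 : measurable_fun setT (fun q : (T * T) * T => (slobodeckij_kernel phi q.1.1 q.1.2 q.2)%:E).
  have -> : (fun q : (T * T) * T => (slobodeckij_kernel phi q.1.1 q.1.2 q.2)%:E) =
    (fun q : (T * T) * T => (`|phi (q.1.2, q.1.1) - phi (q.2, q.1.1)| ^+ 2 * `|(q.1.2 : R) - q.2| `^ (- (7 / 3)))%:E).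
    by apply/funext => q; rewrite /slobodeckij_kernel powRN.
  have m11 : measurable_fun setT (fun q : (T * T) * T => (q.1.1 : R)).
    exact: (measurableT_comp measurable_fst measurable_fst).
  have m12 : measurable_fun setT (fun q : (T * T) * T => (q.1.2 : R)).
    exact: (measurableT_comp measurable_snd measurable_fst).
  have m2 : measurable_fun setT (fun q : (T * T) * T => (q.2 : R)) by exact: measurable_snd.
  apply/measurable_EFinP/measurable_funM.
    apply: measurable_funX; apply: measurableT_comp => //.
    by apply: measurable_funB; apply: measurable_line.
  by apply: measurable_abs_powR; apply: measurable_funB.
have K30 (q : (T * T) * T) : (0 <= (slobodeckij_kernel phi q.1.1 q.1.2 q.2)%:E)%E.
  by rewrite lee_fin slobodeckij_kernel_ge0.
have mK2 := measurable_fun_fubini_tonelli_F (m2 := mu) _ mK3 K30.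
have K20 (p : T * T) : (0 <= fubini_F mu (fun q : (T * T) * T => (slobodeckij_kernel phi q.1.1 q.1.2 q.2)%:E) p)%E.
  by apply: integral_ge0 => t _; exact: K30.
have mK1 := measurable_fun_fubini_tonelli_F (m2 := mu) _ mK2 K20.
apply: (@le_trans _ _ (\int[mu]_z (2%:E * \int[mu]_x \int[mu]_t (gagliardo phi ((x, z), t))%:E))%E).
  apply: ge0_le_integral => //.
  - by move=> z _; apply: integral_ge0 => x _; apply: integral_ge0 => y _; rewrite lee_fin slobodeckij_kernel_ge0.
  - by apply: measurable_funeM; exact: mH.
  - by move=> z _; exact: slobodeckij_le_gagliardo.
rewrite ge0_integralZl; [|exact: measurableT|exact: mH| |by rewrite lee_fin]; last first.
  by move=> z _; apply: integral_ge0 => x _; exact: F0.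
have -> : (\int[mu]_z \int[mu]_x \int[mu]_t (gagliardo phi ((x, z), t))%:E =
    \int[mu2]_p \int[mu]_t (gagliardo phi (p, t))%:E)%E by exact: esym f.
have two0 : (0 <= 2%:E :> \bar R)%E by rewrite lee_fin.
apply: (le_trans (lee_wpmul2l two0 (integral_gagliardo_le Z))).
have s0 (g : R * R -> R) : (0 <= \int[mu2]_p (g p ^+ 2)%:E)%E.
  by apply: integral_ge0 => p _; rewrite lee_fin sqr_ge0.
have n1 : (0 <= 32%:E * \int[mu2]_p (h p ^+ 2)%:E)%E by rewrite mule_ge0 ?lee_fin.
have n2 : (0 <= Cin%:E * \int[mu2]_p (gzz p ^+ 2)%:E)%E.
  by rewrite mule_ge0 ?lee_fin ?Cin_ge0.
by rewrite (ge0_muleDr _ n1 n2) !muleA -!EFinM.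
Qed.

End embedding.

Theorem proposition1p6 (R : realType) :
  exists C : R, 0 < C /\
    forall phi gz gzz h : R * R -> R, inZ0 phi gz gzz h ->
      (H23xL2z_norm phi <= C%:E * Z0norm phi gz gzz h)%E.
Proof.
have C0 := @Cin_ge0 R.
(* [K] is the sum of the constants bounding the squared norm. Since [K >= 1] gives [K <= K^2], it
   also serves as the constant after the square root. *)
pose K : R := 1 + 2 * 32 + 2 * Cin.
have K1 : 1 <= K by rewrite /K; lra.
exists K; split=> [|phi gz gzz h Z]; first exact: lt_le_trans K1.
have S := slobodeckij_le Z.
have [L2phi [L2gz [L2gzz [L2h _]]]] := Z.
(* All the norms on the right are finite, so naming them as real numbers leaves a polynomial
   inequality. *)
have L2E f : L2 f -> exists2 a : R, 0 <= a & L2norm f = a%:E /\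
    (\int[@leb2 R]_p (`|f p| ^+ 2)%:E = (a ^+ 2)%:E)%E.
  move=> [mf foo].
  have I0 : (0 <= \int[@leb2 R]_p (`|f p| ^+ 2)%:E)%E.
    by apply: integral_ge0 => p _; rewrite lee_fin exprn_ge0.
  have N0 : (0 <= L2norm f)%E by exact: Lnorm_ge0.
  have NE : (L2norm f * L2norm f = \int[@leb2 R]_p (`|f p| ^+ 2)%:E)%E.
    by rewrite /L2norm Lnorm2E poweR_half_sq.
  have Nfin : L2norm f \is a fin_num.
    rewrite ge0_fin_numE// ltey; apply/eqP => Ny.
    by move: NE foo; rewrite Ny mulyy => <-.
  exists (fine (L2norm f)); first exact: fine_ge0.
  by rewrite fineK// -NE expr2 EFinM fineK.
have [a a0 [na ia]] := L2E _ L2phi.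
have [b b0 [nb ib]] := L2E _ L2gz.
have [c c0 [nc ic]] := L2E _ L2gzz.
have [d d0 [nd id_]] := L2E _ L2h.
have sqE (f : R * R -> R) : (\int[area]_p (f p ^+ 2)%:E = \int[@leb2 R]_p (`|f p| ^+ 2)%:E)%E.
  by apply: eq_integral => p _; rewrite real_normK ?num_real.
rewrite (sqE h) (sqE gzz) id_ ic -!EFinM -EFinD in S.
rewrite /H23xL2z_norm /Z0norm na nb nc nd ia -!EFinD -EFinM.
set N := d + c + b + a.
have N0 : 0 <= N by rewrite !addr_ge0.
have KN0 : 0 <= K * N by rewrite mulr_ge0// (le_trans ler01).
have sqrtE (y : R) : 0 <= y -> (y%:E = (y ^+ 2)%:E `^ 2^-1)%E.
  by move=> y0; rewrite expr2 EFinM poweRM ?lee_fin// poweR_half_sq ?lee_fin.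
rewrite (sqrtE _ KN0).
apply: gt0_ler_poweR; rewrite ?invr_ge0// ?in_itv/= ?leey ?andbT ?lee_fin ?sqr_ge0//.
  rewrite adde_ge0 ?lee_fin ?sqr_ge0// integral_ge0// => z _.
  apply: integral_ge0 => x _; apply: integral_ge0 => y _.
  by rewrite lee_fin divr_ge0 ?powR_ge0 ?exprn_ge0.
apply: (@le_trans _ _ ((a ^+ 2)%:E + (2 * 32 * d ^+ 2 + 2 * Cin * c ^+ 2)%:E)%E).
  by apply: leeD => //; exact: S.
rewrite -EFinD lee_fin.
have le_sq (u : R) : 0 <= u -> u <= N -> u ^+ 2 <= N ^+ 2.
  by move=> u0 uN; rewrite lerXn2r ?nnegrE.
have aN := le_sq a a0 ltac:(by rewrite /N lerDr !addr_ge0).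
have cN := le_sq c c0 ltac:(by rewrite /N -!addrA addrCA lerDl !addr_ge0).
have dN := le_sq d d0 ltac:(by rewrite /N -!addrA lerDl !addr_ge0).
apply: (@le_trans _ _ (K * N ^+ 2)).
  have KE : K * N ^+ 2 = N ^+ 2 + (2 * 32 * N ^+ 2 + 2 * Cin * N ^+ 2) by rewrite /K; ring.
  rewrite KE; apply: lerD; first exact: aN.
  by apply: lerD; rewrite ler_wpM2l// mulr_ge0.
rewrite exprMn ler_wpM2r ?sqr_ge0// expr2 -[leLHS]mulr1 ler_wpM2l//.
exact: le_trans K1.
Qed.
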